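(* Let $d\ge3$, let $V\in RH_q$ with $q>d/2$, $V\not\equiv0$, and let $\rho$ be the critical radius function of $V$. Let $g\in L^1_{\mathrm{loc}}(\mathbb{R}^d)$, $\theta\ge0$ and $0<\delta<1$. Then $(M^\theta g)^\delta\in A_1^{\rho,\infty}$.
   Context: Reverse Hölder class: for $q>1$, $V\in RH_q$ means that $V:\mathbb{R}^d\to\mathbb{R}$ is a non-negative locally integrable function for which there is a constant $C$ with $\left(\frac{1}{|B|}\int_B V^q\right)^{1/q}\le \frac{C}{|B|}\int_B V$ for every ball $B\subset\mathbb{R}^d$. Critical radius function: $\rho(x)=\sup\{r>0:\ \frac{1}{r^{d-2}}\int_{B(x,r)}V\le 1\}$, $x\in\mathbb{R}^d$; under the present assumptions $0<\rho(x)<\infty$ for all $x$. Maximal function: for $\theta\ge0$, $M^\theta f(x)=\sup_{r>0}\frac{1}{\left(1+\frac{r}{\rho(x)}\right)^\theta}\,\frac{1}{|B(x,r)|}\int_{B(x,r)}|f|$. Weights: $A_1^{\rho,\infty}=\bigcup_{\theta\ge0}A_1^{\rho,\theta}$, where $A_1^{\rho,\theta}$ is the set of weights $w$ such that for some constant $C$, $\frac{1}{|B|}\int_B w\le C\left(1+\frac{r}{\rho(x)}\right)^\theta\inf_B w$ for every ball $B=B(x,r)$ (with $\inf$ the essential infimum). In this statement a weight is a non-negative measurable function with values in $[0,\infty]$, and the inequality is understood in $[0,\infty]$ (so the degenerate cases where the function is identically $0$ or $+\infty$ are allowed). *)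

(* Defs.v *)
From HB Require Import structures.
From mathcomp Require Import all_boot all_order all_algebra.
From mathcomp Require Import all_classical all_reals all_analysis.
From mathcomp Require Import measurable_realfun ess_sup_inf.
Import Order.TTheory GRing.Theory Num.Theory.
Import numFieldNormedType.Exports.

Set Implicit Arguments.
Unset Strict Implicit.
Unset Printing Implicit Defensive.

Local Open Scope classical_set_scope.
Local Open Scope ring_scope.
Local Open Scope ereal_scope.

Section lebesgue.
Variables (R : realType) (d : nat).

Definition box (a b : 'rV[R]_d) : set 'rV[R]_d :=
  [set x | forall i, (a ord0 i <= x ord0 i < b ord0 i)%R].

Definition box_volume (a b : 'rV[R]_d) : R :=
  (\prod_(i < d) Num.max 0 (b ord0 i - a ord0 i))%R.

(* The predicate [c.1] selects the indices in use, so that finite covers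
   are allowed; when [d = 0] every box is nonempty, and [set0] needs the empty
   cover. *)
Definition box_cover (A : set 'rV[R]_d) :=
  [set c : pred nat * (nat -> 'rV[R]_d * 'rV[R]_d) |
    A `<=` \bigcup_(k in [set k | c.1 k]) box (c.2 k).1 (c.2 k).2].

Definition lebesgue_outer (A : set 'rV[R]_d) : \bar R :=
  ereal_inf [set \sum_(0 <= k <oo | c.1 k) (box_volume (c.2 k).1 (c.2 k).2)%:E
            | c in box_cover A].

Lemma box_volume_ge0 a b : (0 <= box_volume a b)%R.
Proof. by apply: prodr_ge0 => i _; rewrite le_max lexx. Qed.

Lemma lebesgue_outer_ge0 A : 0 <= lebesgue_outer A.
Proof.
apply: le_ereal_inf_tmp => _ [c _ <-]; apply: nneseries_ge0 => n _ _.
by rewrite lee_fin box_volume_ge0.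
Qed.

Lemma lebesgue_outer0 : lebesgue_outer set0 = 0.
Proof.
apply/eqP; rewrite eq_le lebesgue_outer_ge0 andbT.
apply: ereal_inf_lbound; exists (xpred0, fun=> (0%R, 0%R)) => //=.
by rewrite eseries_cond eseries0.
Qed.

Lemma le_lebesgue_outer : {homo lebesgue_outer : A B / A `<=` B >-> A <= B}.
Proof.
move=> A B AB; apply/ereal_inf_le_tmp => _ [c Bc <-].
by exists c => //; apply: subset_trans AB Bc.
Qed.

Lemma lebesgue_outer_sigma_subadditive : sigma_subadditive lebesgue_outer.
Proof.
move=> A; have [[i ioo]|] := pselect (exists i, lebesgue_outer (A i) = +oo).
  rewrite (eseries_pinfty _ _ ioo) ?leey// => n _.
  by rewrite -ltNye (lt_le_trans _ (lebesgue_outer_ge0 _)).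
rewrite -forallNE => Aoo.
suff add2e (e : {posnum R}) : lebesgue_outer (\bigcup_n A n) <=
    \sum_(i <oo) lebesgue_outer (A i) + e%:num%:E.
  by apply/lee_addgt0Pr => _/posnumP[].
rewrite (le_trans _ (epsilon_trick _ _ _))//; last first.
  by move=> n; exact: lebesgue_outer_ge0.
pose vol (c : pred nat * (nat -> 'rV[R]_d * 'rV[R]_d)) k :=
  if c.1 k then (box_volume (c.2 k).1 (c.2 k).2)%:E else 0.
have vol_ge0 c k : 0 <= vol c k.
  by rewrite /vol; case: ifP => // _; rewrite lee_fin box_volume_ge0.
have volE c : \sum_(0 <= k <oo | c.1 k) (box_volume (c.2 k).1 (c.2 k).2)%:E =
    \sum_(k <oo) vol c k by rewrite eseries_mkcond.
pose P n c := box_cover (A n) c /\ \sum_(k <oo) vol c k <=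
    lebesgue_outer (A n) + (e%:num / (2 ^ n.+1)%:R)%:E.
have [G PG] : {G & forall n, P n (G n)}.
  apply: (@choice _ _ P) => n.
  have fA : lebesgue_outer (A n) \is a fin_num.
    by rewrite ge0_fin_numE ?lebesgue_outer_ge0// ltey; apply/eqP/Aoo.
  have en1 : (0 < e%:num / (2 ^ n.+1)%:R :> R)%R by [].
  have [_ [c Ac <-] /ltW ce] := lb_ereal_inf_adherent en1 fA.
  by exists c; split => //; rewrite -volE.
apply: (@le_trans _ _ (\sum_(i <oo) \sum_(k <oo) vol (G i) k)); last first.
  apply: lee_nneseries => [n _ _|n _]; first exact: nneseries_ge0.
  exact: (PG n).2.
have /card_esym/ppcard_eqP[f] := card_nat2.
apply: (@le_trans _ _ (\sum_(k <oo) vol (G (f k).1) (f k).2)).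
  apply: ereal_inf_lbound.
  exists ((fun k => (G (f k).1).1 (f k).2), (fun k => (G (f k).1).2 (f k).2)).
    move=> x [n _ /(PG n).1[k /= Pk kx]].
    by exists (f^-1%FUN (n, k)) => /=; rewrite invK ?inE.
  by rewrite volE.
rewrite nneseries_esumT; last by move=> *; exact: vol_ge0.
rewrite (_ : \sum_(i <oo) _ = \esum_(i in setT) \esum_(k in setT) vol (G i) k).
  rewrite esum_esum; last by move=> *; exact: vol_ge0.
  have -> : [set: nat] `*`` (fun=> [set: nat]) = [set: nat * nat].
    by apply/seteqP; split.
  by rewrite (reindex_esum setT _ f).
rewrite nneseries_esumT; last by move=> *; exact: nneseries_ge0.
by apply: eq_esum => i _; rewrite nneseries_esumT// => *; exact: vol_ge0.
Qed.

HB.instance Definition _ := isOuterMeasure.Build R _ lebesgue_outer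
  lebesgue_outer0 lebesgue_outer_ge0 le_lebesgue_outer
  lebesgue_outer_sigma_subadditive.

(* ['rV[R]_d] with the sigma-algebra of Lebesgue measurable sets. *)
Definition euclid := caratheodory_type lebesgue_outer.

Definition lebesgue : set euclid -> \bar R := lebesgue_outer.

Lemma lebesgue_semi_sigma_additive : semi_sigma_additive lebesgue.
Proof. exact: caratheodory_measure_sigma_additive. Qed.

HB.instance Definition _ := isMeasure.Build _ _ _ lebesgue
  lebesgue_outer0 lebesgue_outer_ge0 lebesgue_semi_sigma_additive.

End lebesgue.

Section schroedinger_weights.
Variables (R : realType) (d : nat).
Local Notation mu := (@lebesgue R d).

Definition enorm (x : 'rV[R]_d) : R := Num.sqrt (\sum_(i < d) x ord0 i ^+ 2)%R.

(* The library's [ball] on ['rV[R]_d] is the one of the sup norm. *)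
Definition eball (x : 'rV[R]_d) (r : R) : set 'rV[R]_d :=
  [set y | (enorm (y - x) < r)%R].

Definition average (f : 'rV[R]_d -> \bar R) (B : set 'rV[R]_d) : \bar R :=
  (mu B)^-1 * \int[mu]_(y in B) f y.

Definition L1loc (f : 'rV[R]_d -> R) : Prop :=
  measurable_fun [set: euclid R d] f /\
  forall K : set 'rV[R]_d, compact K -> \int[mu]_(y in K) `|f y|%:E < +oo.

Definition reverse_holder (q : R) (V : 'rV[R]_d -> R) : Prop :=
  [/\ forall x, (0 <= V x)%R,
      L1loc V &
      exists C : R, forall (x : 'rV[R]_d) (r : R), (0 < r)%R ->
        average (fun y => (V y `^ q)%:E) (eball x r) `^ q^-1
        <= C%:E * average (fun y => (V y)%:E) (eball x r)].

Definition critical_radius (V : 'rV[R]_d -> R) (x : 'rV[R]_d) : \bar R :=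
  ereal_sup [set r%:E | r in [set r : R | (0 < r)%R /\
    ((r ^+ (d - 2))^-1)%:E * \int[mu]_(y in eball x r) (V y)%:E <= 1]].

Section weights.
Variable rho : 'rV[R]_d -> \bar R.

Definition growth (theta : R) (x : 'rV[R]_d) (r : R) : \bar R :=
  (1 + r%:E / rho x) `^ theta.

Definition maximal_fun (theta : R) (f : 'rV[R]_d -> R) (x : 'rV[R]_d) : \bar R :=
  ereal_sup [set (growth theta x r)^-1 *
                 average (fun y => `|f y|%:E) (eball x r)
            | r in [set r : R | (0 < r)%R]].

Definition weight (w : 'rV[R]_d -> \bar R) : Prop :=
  measurable_fun [set: euclid R d] w /\ forall x, 0 <= w x.

(* Extending [w] by [+oo] outside of [B] makes the library's global essential
   infimum the one over [B]. *)
Definition ess_inf_on (B : set 'rV[R]_d) (w : 'rV[R]_d -> \bar R) : \bar R :=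
  ess_inf mu (patch (cst +oo) B w).

Definition A1_theta (theta : R) (w : 'rV[R]_d -> \bar R) : Prop :=
  weight w /\
  exists C : R, forall (x : 'rV[R]_d) (r : R), (0 < r)%R ->
    average w (eball x r)
    <= C%:E * growth theta x r * ess_inf_on (eball x r) w.

Definition A1_infty (w : 'rV[R]_d -> \bar R) : Prop :=
  exists2 theta : R, (0 <= theta)%R & A1_theta theta w.

End weights.
End schroedinger_weights.

(* Main.v *)
Require Import Defs.
From mathcomp Require Import all_boot all_order all_algebra.
From mathcomp Require Import all_classical all_reals all_analysis.
From mathcomp Require Import measurable_realfun ess_sup_inf lra.

Import Order.TTheory GRing.Theory Num.Theory.
Import numFieldNormedType.Exports.

(** Write [rho] for the critical radius, [w = (M^theta g)^delta], fix a ball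
    [B = B(x,r)] and put [u = 1 + r/rho(x)].  For [y, z] in [B], the averages
    defining [M^theta g (y)] over balls of radius [s < r] only see [g] on
    [2B], and those with [s >= r] are at most [3^d (C u^k)^theta M^theta g (z)]
    because [B(y,s)] is contained in [B(z,3s)] and
    [1 + 3s/rho(z) <= C u^k (1 + s/rho(y))].  The first ones are controlled in
    mean of order [delta] by Kolmogorov's inequality, that is by the average of
    [|g|] over [2B], hence again by a power of [u] times [M^theta g (z)].

    The comparison of [rho] at different points comes from two consequences of
    the reverse Hoelder inequality for the mass [v(x,r)] of [V] on [B(x,r)]: the
    decay [v(x,t) <= K (t/T)^(d-d/q) v(x,T)] for [t <= T], where
    [d - d/q > d - 2], and the doubling property. *)

Set Implicit Arguments.
Unset Strict Implicit.
Unset Printing Implicit Defensive.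

Local Open Scope classical_set_scope.
Local Open Scope ring_scope.

(** * Euclidean balls *)

(** The condition [q > d/2] enters through [e = 2 - d/q > 0]: the quotient [v(x,t) / t^(d-2)] is, up
    to a constant, at most [(t/T)^e] times its value at [T >= t]. It therefore tends to [0] with
    [t], which makes [rho] positive, and to infinity at large radii when [V] is not almost
    everywhere zero, which makes [rho] finite. Moreover a bound [v(y,S) <= M S^(d-2)] turns into
    [rho(y) >= S (K M)^(-1/e)], and doubling supplies such a bound with [M] polynomial in
    [1 + |x-y|/rho(x)].

    The local part of [M^theta g] satisfies a weak type (1,1) bound only, so it need not be
    integrable; the power [delta < 1] restores integrability.

    Measurability of [rho] and of [M^theta g] is part of the claim, and both are suprema over
    uncountably many radii. Integrals over balls are lower semicontinuous in the centre and left
    continuous in the radius, which permits a reduction to rational radii.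

    The final weight exponent is [(k+1) theta delta]: the power [k] comes from comparing [rho] at
    two points of [B], the extra one from the factor [1 + r/rho(x)] of the ball itself. *)

Section euclidean_balls.
Context {R : realType} {d : nat}.
Implicit Types x y z : 'rV[R]_d.

Lemma enorm_ge0 x : 0 <= enorm x.
Proof. exact: sqrtr_ge0. Qed.

Lemma enorm0 : enorm (0 : 'rV[R]_d) = 0.
Proof.
rewrite /enorm big1 ?sqrtr0// => i _; by rewrite mxE expr0n.
Qed.

Lemma enormN x : enorm (- x) = enorm x.
Proof. by rewrite /enorm; under eq_bigr do rewrite mxE sqrrN. Qed.

Lemma enormZ a x : 0 <= a -> enorm (a *: x) = a * enorm x.
Proof.
move=> a0; rewrite /enorm; under eq_bigr do rewrite mxE exprMn.
by rewrite -mulr_sumr sqrtrM ?sqr_ge0// sqrtr_sqr ger0_norm.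
Qed.

Lemma sqr_enorm x : enorm x ^+ 2 = \sum_(i < d) x ord0 i ^+ 2.
Proof. by rewrite sqr_sqrtr// sumr_ge0// => i _; exact: sqr_ge0. Qed.

(** Cauchy-Schwarz by Lagrange's identity: twice the difference of the squares is the double sum of
    [(x_i y_j - x_j y_i)^2]. *)
Lemma sum_coord_le_enorm x y : \sum_(i < d) x ord0 i * y ord0 i <= enorm x * enorm y.
Proof.
apply: le_trans (ler_norm _) _.
rewrite -(@ler_pXn2r _ 2)// ?nnegrE ?mulr_ge0 ?enorm_ge0//.
rewrite real_normK ?num_real// exprMn !sqr_enorm -subr_ge0.
rewrite -(@pmulr_lge0 _ 2)//.
rewrite (_ : _ * 2 = \sum_(i < d) \sum_(j < d)
    (x ord0 i * y ord0 j - x ord0 j * y ord0 i) ^+ 2).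
  by apply: sumr_ge0 => i _; apply: sumr_ge0 => j _; exact: sqr_ge0.
have -> : \sum_(i < d) \sum_(j < d)
    (x ord0 i * y ord0 j - x ord0 j * y ord0 i) ^+ 2 =
  \sum_(i < d) \sum_(j < d) x ord0 i ^+ 2 * y ord0 j ^+ 2 +
  \sum_(i < d) \sum_(j < d) y ord0 i ^+ 2 * x ord0 j ^+ 2 -
  2 * \sum_(i < d) \sum_(j < d) (x ord0 i * y ord0 i) * (x ord0 j * y ord0 j).
  rewrite mulr_sumr -big_split -sumrB; apply: eq_bigr => i _.
  rewrite mulr_sumr -big_split -sumrB; apply: eq_bigr => j _ /=; lra.
rewrite -!big_distrlr/= expr2; lra.
Qed.

Lemma ler_enormD x y : enorm (x + y) <= enorm x + enorm y.
Proof.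
rewrite -(@ler_pXn2r _ 2)// ?nnegrE ?addr_ge0 ?enorm_ge0//.
rewrite sqrrD !sqr_enorm.
under eq_bigr do rewrite mxE sqrrD.
rewrite !big_split/= lerD2r lerD2l -mulr2n lerMn2r/=.
exact: sum_coord_le_enorm.
Qed.

Lemma ler_edistD y x z : enorm (x - z) <= enorm (x - y) + enorm (y - z).
Proof. by apply: le_trans (ler_enormD _ _); rewrite addrA subrK. Qed.

Lemma edistC x y : enorm (x - y) = enorm (y - x).
Proof. by rewrite -enormN opprB. Qed.

Lemma ler_coord_enorm x i : `|x ord0 i| <= enorm x.
Proof.
rewrite -sqrtr_sqr /enorm ler_sqrt ?sumr_ge0//; last by move=> *; exact: sqr_ge0.
by rewrite (bigD1 i)//= lerDl sumr_ge0// => *; exact: sqr_ge0.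
Qed.

Lemma enorm_le_coord x (M : R) : (forall i, `|x ord0 i| <= M) ->
  enorm x <= d%:R * M.
Proof.
case: d x => [|n] x xM.
  by rewrite /enorm big_ord0 sqrtr0 mul0r.
have M0 : 0 <= M by apply: le_trans (xM ord0); exact: normr_ge0.
rewrite -(@ler_pXn2r _ 2)// ?nnegrE ?mulr_ge0 ?enorm_ge0//.
rewrite /enorm sqr_sqrtr ?sumr_ge0//; last by move=> *; exact: sqr_ge0.
apply: (@le_trans _ _ (\sum_(i < n.+1) M ^+ 2)).
  apply: ler_sum => i _; rewrite -real_normK ?num_real//.
  by rewrite ler_pXn2r ?nnegrE//.
rewrite sumr_const card_ord exprMn -[leLHS]mulr_natl ler_wpM2r ?sqr_ge0//.
rewrite -natrX ler_nat leq_pmulr//.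
exact: sqrtr_ge0.
Qed.

Lemma eball_sub x y (r s : R) : enorm (x - y) + r <= s ->
  eball x r `<=` eball y s.
Proof.
move=> h z; rewrite /eball/= => zx; have := ler_edistD x z y; lra.
Qed.

Lemma eball_center x (r : R) : 0 < r -> eball x r x.
Proof. by move=> r0; rewrite /eball/= subrr enorm0. Qed.

(** Openness is expressed with Euclidean balls, so that no comparison with the sup-norm topology of
    the library is needed. *)
Definition eopen (U : set 'rV[R]_d) :=
  forall x, U x -> exists2 e : R, 0 < e & eball x e `<=` U.

Lemma eopen_eball x (r : R) : eopen (eball x r).
Proof.
move=> y yx; exists (r - enorm (y - x)); first by rewrite subr_gt0.
by apply: eball_sub; rewrite addrC subrK.
Qed.

End euclidean_balls.

(** * Lebesgue measure of balls *)

Section lebesgue_measure_of_balls.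
Context {R : realType} {d : nat}.
Implicit Types x y z : 'rV[R]_d.
Local Notation mu := (@lebesgue R d).
Local Open Scope ereal_scope.

(** The inverse affine map sends a box cover of [A] to a box cover of the preimage, and multiplies
    every volume by [a^-d]. *)
Lemma lebesgue_outer_dilate_le (a : R) x (A : set 'rV[R]_d) : (0 < a)%R ->
  lebesgue_outer [set y | A (a *: y + x)%R] <= ((a ^-1) ^+ d)%:E * lebesgue_outer A.
Proof.
move=> a0; have ad0 : (0 < a^-1 ^+ d)%R by rewrite exprn_gt0 ?invr_gt0.
rewrite -lee_pdivrMl//; apply: le_ereal_inf_tmp => _ [c Ac <-].
rewrite lee_pdivrMl// -nneseriesZl//; last first.
  by move=> *; rewrite lee_fin box_volume_ge0.
apply: ereal_inf_lbound.
exists (c.1, fun k => (a^-1 *: ((c.2 k).1 - x), a^-1 *: ((c.2 k).2 - x))%R).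
  move=> y /= /Ac[k /= ck yk]; exists k => //= i.
  move: (yk i); rewrite !mxE => /andP[h1 h2].
  by rewrite ler_pdivrMl// ltr_pdivlMl// lerBlDr ltrBrDr h1.
apply: eq_eseriesr => k _; rewrite -EFinM; congr EFin.
have -> : (a^-1 ^+ d = \prod_(i < d) a^-1)%R by rewrite prodr_const card_ord.
rewrite /box_volume /= -big_split/=.
apply: eq_bigr => i _; rewrite !mxE -mulrBr maxr_pMr ?invr_ge0 ?ltW// mulr0.
by congr (Num.max _ (_ * _)%R); lra.
Qed.

Lemma lebesgue_outer_dilate (a : R) x (A : set 'rV[R]_d) : (0 < a)%R ->
  lebesgue_outer [set y | A (a *: y + x)%R] = ((a ^-1) ^+ d)%:E * lebesgue_outer A.
Proof.
move=> a0; have ad0 : (0 < a^-1 ^+ d)%R by rewrite exprn_gt0 ?invr_gt0.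
apply/eqP; rewrite eq_le lebesgue_outer_dilate_le//= -lee_pdivlMl//.
have a'0 : (0 < a^-1)%R by rewrite invr_gt0.
(* The reverse inequality is the same bound for the inverse affine map. *)
have := lebesgue_outer_dilate_le (- (a^-1 *: x))%R [set y | A (a *: y + x)%R] a'0.
rewrite invrK exprVn invrK.
congr (_ <= _); congr lebesgue_outer; apply/seteqP; split => y /=;
  by rewrite scalerDr scalerN !scalerA divff ?gt_eqF// !scale1r subrK.
Qed.

Lemma lebesgue_eball x (r : R) : (0 < r)%R ->
  mu (eball x r) = (r ^+ d)%:E * mu (eball (0%R : 'rV_d) 1).
Proof.
move=> r0; have r'0 : (0 < r^-1)%R by rewrite invr_gt0.
have := lebesgue_outer_dilate (- (r^-1 *: x))%R (eball 0%R 1) r'0.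
rewrite invrK => <-; congr lebesgue_outer; apply/seteqP; split => y;
  rewrite /eball /= subr0 -scalerBr enormZ ?invr_ge0 ?ltW//;
  by rewrite ltr_pdivrMl ?mulr1.
Qed.

Lemma lebesgue_box_le (a b : 'rV[R]_d) :
  lebesgue_outer (box a b) <= (box_volume a b)%:E.
Proof.
apply: ereal_inf_lbound; exists (fun k => k == 0%N, fun=> (a, b)) => /=.
  by move=> y aby; exists 0%N => //=.
rewrite (@nneseriesD1 _ _ 0%N)//=; last by move=> *; rewrite lee_fin box_volume_ge0.
rewrite eseries0 ?adde0// => k _ /andP[/eqP-> //].
Qed.

Lemma lebesgue_eball_lty x (r : R) : mu (eball x r) < +oo.
Proof.
apply: (@le_lt_trans _ _ (lebesgue_outer (box (x - const_mx r) (x + const_mx r))%R)).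
  apply: le_lebesgue_outer => y; rewrite /eball /box /= => yr i.
  have := ler_coord_enorm (y - x)%R i; rewrite !mxE.
  move=> /le_lt_trans/(_ yr); rewrite ltr_norml => /andP[? ?].
  by apply/andP; split; lra.
by apply: le_lt_trans (lebesgue_box_le _ _) _; rewrite ltey.
Qed.

Definition half_space (i : 'I_d) (a : R) : set 'rV[R]_d :=
  [set x | (x ord0 i < a)%R].

(** The hyperplane cuts each box of a cover into two boxes whose volumes add up, so a cover of [X]
    splits into covers of its two parts at no cost. *)
Lemma caratheodory_half_space i a :
  (@lebesgue_outer R d).-caratheodory (half_space i a).
Proof.
apply: le_caratheodory_measurable => X; apply: le_ereal_inf_tmp => _ [c Xc <-].
pose low (b : 'rV[R]_d) : 'rV[R]_d :=
  (\row_j if j == i then Num.min a (b ord0 j) else b ord0 j)%R.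
pose high (b : 'rV[R]_d) : 'rV[R]_d :=
  (\row_j if j == i then Num.max a (b ord0 j) else b ord0 j)%R.
have volE (p q : 'rV[R]_d) :
    (box_volume p q = box_volume p (low q) + box_volume (high p) q)%R.
  have volD (v w : 'rV[R]_d) : (box_volume v w = Num.max 0 (w ord0 i - v ord0 i) *
      \prod_(j < d | j != i) Num.max 0 (w ord0 j - v ord0 j))%R.
    by rewrite /box_volume (bigD1 i).
  rewrite !volD !mxE eqxx.
  rewrite [X in _ = (_ * X + _)%R](eq_bigr (fun j =>
    Num.max 0 (q ord0 j - p ord0 j))%R); last first.
    by move=> j /negPf ji; rewrite mxE ji.
  rewrite [X in _ = (_ + _ * X)%R](eq_bigr (fun j =>
    Num.max 0 (q ord0 j - p ord0 j))%R); last first.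
    by move=> j /negPf ji; rewrite mxE ji.
  rewrite -mulrDl; congr (_ * _)%R.
  (* Truncating side lengths at [0] keeps additivity true when the hyperplane misses the box. *)
  rewrite !maxEle !minEle; repeat case: ifP; move=> *; lra.
pose vol (c : pred nat * (nat -> 'rV[R]_d * 'rV[R]_d)) :=
  \sum_(0 <= k <oo | c.1 k) (box_volume (c.2 k).1 (c.2 k).2)%:E.
pose cl := (c.1, fun k => ((c.2 k).1, low (c.2 k).2)).
pose ch := (c.1, fun k => (high (c.2 k).1, (c.2 k).2)).
rewrite [leRHS](_ : _ = vol cl + vol ch); last first.
  rewrite /vol -nneseriesD//=; last 2 first.
    by move=> *; rewrite lee_fin box_volume_ge0.
    by move=> *; rewrite lee_fin box_volume_ge0.
  by apply: eq_eseriesr => k _; rewrite volE.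
apply: leeD; apply: ereal_inf_lbound.
  exists cl => // y [/Xc[k /= ck yk] ya]; exists k => //= j; rewrite mxE.
  have /andP[h1 h2] := yk j; rewrite h1/=; case: eqP => // ji.
  by rewrite lt_min h2 andbT ji.
exists ch => // y [/Xc[k /= ck yk] ya]; exists k => //= j; rewrite mxE.
have /andP[h1 h2] := yk j; rewrite h2 andbT; case: eqP => // ji.
by rewrite ge_max h1 andbT ji leNgt; apply/negP.
Qed.

Lemma measurable_half_space i a : measurable (half_space i a : set (euclid R d)).
Proof. exact: caratheodory_half_space. Qed.

Lemma measurable_box (a b : 'rV[R]_d) : measurable (box a b : set (euclid R d)).
Proof.
have -> : box a b = \bigcap_(i in [set: 'I_d])
   (~` half_space i (a ord0 i) `&` half_space i (b ord0 i)).
  apply/seteqP; split=> y yab i.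
    move=> _; have /andP[h1 h2] := yab i; split => //=.
    by apply/negP; rewrite -leNgt.
  by have [/negP + h2] := yab i I; rewrite -leNgt => ->.
apply: (@fin_bigcap_measurable _ (euclid R d)) => //= i _.
apply: measurableI; last exact: measurable_half_space.
exact/measurableC/measurable_half_space.
Qed.

(** An open set is the union of the boxes with rational corners that it contains, and these are
    countably many. *)
Lemma measurable_eopen (U : set 'rV[R]_d) : eopen U ->
  measurable (U : set (euclid R d)).
Proof.
move=> oU; pose q2r (q : 'rV[rat]_d) : 'rV[R]_d := map_mx ratr q.
pose F (q : 'rV[rat]_d * 'rV[rat]_d) : set (euclid R d) :=
  if `[< box (q2r q.1) (q2r q.2) `<=` U >] then box (q2r q.1) (q2r q.2) else set0.
have -> : U = \bigcup_q F q.
  apply/seteqP; split => x; last first.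
    by move=> [q _]; rewrite /F; case: asboolP => // qU /qU.
  (* The denominator [d.+1] gives the strict bound [d * h < e] and is nonzero even for [d = 0]. *)
  move=> /oU[e e0 eU]; pose h := (e / d.+1%:R)%R.
  have h0 : (0 < h)%R by rewrite divr_gt0.
  have xa i : exists q : rat, (ratr q \in `](x ord0 i - h)%R, x ord0 i[)%R.
    by have [|q] := @rat_in_itvoo R (x ord0 i - h) (x ord0 i); [lra|exists q].
  have xb i : exists q : rat, (ratr q \in `]x ord0 i, (x ord0 i + h)%R[)%R.
    by have [|q] := @rat_in_itvoo R (x ord0 i) (x ord0 i + h); [lra|exists q].
  have [a ha] := choice xa; have [b hb] := choice xb.
  exists (\row_i a i, \row_i b i)%R => //; rewrite /F; case: asboolP => /=.
    move=> _ i; rewrite !mxE; have := ha i; have := hb i.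
    by rewrite !in_itv/= => /andP[? ?] /andP[? ?]; apply/andP; split; lra.
  case=> y yab; apply: eU; rewrite /eball/=.
  apply: (@le_lt_trans _ _ (d%:R * h)%R).
    apply: enorm_le_coord => i; rewrite !mxE ler_norml.
    have := yab i; have := ha i; have := hb i; rewrite !mxE !in_itv/=.
    by move=> /andP[? ?] /andP[? ?] /andP[? ?]; apply/andP; split; lra.
  rewrite /h mulrCA gtr_pMr// ltr_pdivrMr// mul1r ltr_nat//.
apply: countable_bigcupT_measurable; first exact: countableP.
move=> q; rewrite /F; case: ifP => _ //; exact: measurable_box.
Qed.

Lemma measurable_eball x (r : R) : measurable (eball x r : set (euclid R d)).
Proof. exact/measurable_eopen/eopen_eball. Qed.

(** Lower semicontinuous functions are measurable. *)
Lemma eopen_measurable_fun (f : 'rV[R]_d -> \bar R) :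
  (forall a : R, eopen [set x | a%:E < f x]) ->
  measurable_fun [set: euclid R d] f.
Proof.
move=> of_; apply: (measurability _ (ErealGenOInfty.measurableE R)).
move=> /= _ [_ [a ->]] <-; apply: measurableI => //.
by rewrite preimage_itvoy; apply: measurable_eopen; exact: of_.
Qed.

End lebesgue_measure_of_balls.

(** * Maximal inequalities *)

Section rational_balls.
Context {R : realType} {d : nat}.
Implicit Types x y z : 'rV[R]_d.

Lemma rat_point_near x (e : R) : 0 < e ->
  exists q : 'rV[rat]_d, enorm (map_mx ratr q - x) < e.
Proof.
move=> e0; pose h := (e / d.+1%:R)%R.
have h0 : (0 < h)%R by rewrite divr_gt0.
have xa i : exists q : rat, (ratr q \in `](x ord0 i), x ord0 i + h[)%R.
  by have [|q] := @rat_in_itvoo R (x ord0 i) (x ord0 i + h); [lra|exists q].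
have [a ha] := choice xa; exists (\row_i a i).
apply: (@le_lt_trans _ _ (d%:R * h)%R).
  apply: enorm_le_coord => i; rewrite !mxE ler_norml.
  by have := ha i; rewrite in_itv/= => /andP[? ?]; apply/andP; split; lra.
by rewrite /h mulrCA gtr_pMr// ltr_pdivrMr// mul1r ltr_nat.
Qed.

Definition rat_ball (q : 'rV[rat]_d * rat) : set 'rV[R]_d :=
  eball (map_mx ratr q.1) (ratr q.2).

(** Moving the centre by less than [h = (s - r) / 4] leaves the interval from [r + h] to [s - h] for
    the rational radius. *)
Lemma rat_ball_between x (r s : R) : 0 < r < s ->
  exists q, [/\ (0 : R) < ratr q.2, rat_ball q x, eball x r `<=` rat_ball q &
    rat_ball q `<=` eball x s].
Proof.
move=> /andP[r0 rs]; pose h := (s - r) / 4.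
have [|q1 hq1] := @rat_point_near x h; first by rewrite /h; lra.
have [|q2] := @rat_in_itvoo R (r + h) (s - h); first by rewrite /h; lra.
rewrite in_itv/= => /andP[rq qs].
have sub : eball x r `<=` rat_ball (q1, q2).
  by apply: eball_sub; rewrite /= edistC; lra.
exists (q1, q2); split => //=; [|exact/sub/eball_center|].
  by move: rq; rewrite /h; lra.
by apply: eball_sub; rewrite /= edistC; move: hq1; rewrite edistC; lra.
Qed.

End rational_balls.

Section ball_integrals.
Context {R : realType} {d : nat}.
Implicit Types x y z : 'rV[R]_d.
Local Notation mu := (@lebesgue R d).
Local Open Scope ereal_scope.
Variable f : 'rV[R]_d -> \bar R.
Hypothesis mf : measurable_fun [set: euclid R d] f.
Hypothesis f0 : forall x, 0 <= f x.

Lemma le_ball_integral (A : set 'rV[R]_d) x (r : R) :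
  measurable (A : set (euclid R d)) -> A `<=` eball x r ->
  \int[mu]_(y in A) f y <= \int[mu]_(y in eball x r) f y.
Proof.
move=> mA Ar; apply: ge0_subset_integral => //; first exact: measurable_eball.
exact: measurable_funTS.
Qed.

(** An open ball is the increasing union of smaller concentric ones, so monotone convergence
    applies. *)
Lemma ball_integral_left_cont x (r : R) (a : \bar R) : (0 < r)%R ->
  a < \int[mu]_(y in eball x r) f y ->
  exists2 s, (0 < s < r)%R & a < \int[mu]_(y in eball x s) f y.
Proof.
(* The shift to [n.+2] keeps the first radius positive. *)
move=> r0 ar; pose rn n := (r * (1 - (n.+2%:R)^-1))%R.
have rn0 n : (0 < rn n < r)%R.
  apply/andP; split; last by rewrite /rn gtr_pMr// ltrBlDr ltrDl invr_gt0.
  by rewrite mulr_gt0// subr_gt0 invf_lt1 ?ltr1n.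
have UE : \bigcup_n eball x (rn n) = eball x r.
  apply/seteqP; split=> y.
    by move=> [n _]; rewrite /eball/= => /lt_trans; apply; case/andP: (rn0 n).
  rewrite /eball /= => yr; pose e := ((r - enorm (y - x)%R) / r)%R.
  have e0 : (0 < e)%R by rewrite divr_gt0// subr_gt0.
  have [n ne] : exists n : nat, (e^-1 < n%:R)%R.
    by exists (Num.bound e^-1); apply: archi_boundP; rewrite invr_ge0 ltW.
  exists n => //=; rewrite /rn mulrBr mulr1.
  have re : (r * e = r - enorm (y - x))%R by rewrite mulrC divfK ?gt_eqF.
  suff : (r * n.+2%:R^-1 < r * e)%R by rewrite re ltrBrDr ltrBrDl.
  rewrite ltr_pM2l// invf_plt ?posrE//; apply: lt_trans ne _.
  by rewrite ltr_nat ltnS leqnSn.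
have cvg : \int[mu]_(y in eball x (rn n)) f y @[n --> \oo] -->
    \int[mu]_(y in eball x r) f y.
  rewrite -UE; apply: ge0_nondecreasing_set_cvg_integral => //.
  - move=> m n mn; apply/subsetPset; apply: eball_sub.
    rewrite subrr enorm0 add0r ler_pM2l// lerD2l lerN2.
    by rewrite lef_pV2 ?posrE// ler_nat.
  - by move=> n; exact: measurable_eball.
  - by move=> n; exact: measurable_funTS.
have : \forall n \near \oo, a < \int[mu]_(y in eball x (rn n)) f y.
  exact: cvg _ (open_ereal_gt' ar).
case=> N _ /(_ N (leqnn N)) /= h; exists (rn N) => //.
Qed.

Lemma ball_integral_rat_ball x (r : R) (a : \bar R) : (0 < r)%R ->
  a < \int[mu]_(y in eball x r) f y ->
  exists q, [/\ (0 < ratr q.2 :> R)%R, (rat_ball q : set 'rV[R]_d) x,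
    rat_ball q `<=` eball x r & a < \int[mu]_(y in rat_ball q) f y].
Proof.
move=> r0 /(ball_integral_left_cont r0)[s sr ha].
have [q [q0 qx sq qr]] := rat_ball_between x sr.
exists q; split => //; apply: lt_le_trans ha _.
by apply: le_ball_integral => //; exact: measurable_eball.
Qed.

(** A slightly smaller ball [B(x,s)] already has integral above [a], and it lies in [B(y,r)] for
    every [y] within [r - s] of [x]. *)
Lemma ball_integral_lsc (r : R) (a : \bar R) : (0 < r)%R ->
  eopen [set x | a < \int[mu]_(y in eball x r) f y].
Proof.
move=> r0 x /= /(ball_integral_left_cont r0)[s /andP[s0 sr] ha].
exists (r - s)%R; first by rewrite subr_gt0.
move=> y; rewrite /eball/= => yx; apply: lt_le_trans ha _.
apply: le_ball_integral; first exact: measurable_eball.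
by apply: eball_sub; rewrite edistC; lra.
Qed.

Lemma measurable_ball_integral (r : R) : (0 < r)%R ->
  measurable_fun [set: euclid R d] (fun x => \int[mu]_(y in eball x r) f y).
Proof. by move=> r0; apply: eopen_measurable_fun => a; exact: ball_integral_lsc. Qed.

Local Notation ball p := (eball p.1 p.2).

Lemma largest_radius (s : seq ('rV[R]_d * R)) : s != [::] ->
  exists2 p, p \in s & forall p', p' \in s -> (p'.2 <= p.2)%R.
Proof.
elim: s => // p [|p' s] IH _.
  by exists p => [|q]; rewrite inE// => /eqP->.
have [//|m ms mmax] := IH _.
have [pm|mp] := leP p.2 m.2.
  exists m; first by rewrite inE ms orbT.
  by move=> q; rewrite inE => /orP[/eqP->//|]; exact: mmax.
exists p; first by rewrite inE eqxx.
move=> q; rewrite inE => /orP[/eqP->//|/mmax].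
by move=> /le_trans; apply; exact: ltW.
Qed.

Lemma measurable_bigsetU_ball (s : seq ('rV[R]_d * R)) :
  measurable (\big[setU/set0]_(p <- s) ball p : set (euclid R d)).
Proof. by apply: bigsetU_measurable => p _; exact: measurable_eball. Qed.

(* Pick a ball of largest radius: the balls meeting it lie in its triple, and the
   other ones lie in the rest of [U], where the induction hypothesis applies. *)
Lemma vitali_weak_type (a : R) (U : set 'rV[R]_d) (s : seq ('rV[R]_d * R)) :
  (0 <= a)%R -> measurable (U : set (euclid R d)) ->
  (forall p, p \in s -> [/\ (0 < p.2)%R, ball p `<=` U &
      a%:E * mu (ball p) <= \int[mu]_(y in ball p) f y]) ->
  a%:E * mu (\big[setU/set0]_(p <- s) ball p) <=
    (3 ^+ d)%:E * \int[mu]_(y in U) f y.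
Proof.
move=> a0; have [n] := ubnP (size s); elim: n U s => // n IH U s sn mU sU.
have [->|s0] := eqVneq s [::].
  rewrite big_nil measure0 mule0 mule_ge0//.
  exact: integral_ge0.
have [p ps pmax] := largest_radius s0; have [p0 pU pa] := sU _ ps.
pose s' := [seq p' <- s | `[< ball p' `&` ball p = set0 >]].
have sub : \big[setU/set0]_(p <- s) ball p `<=`
    eball p.1 (3 * p.2) `|` \big[setU/set0]_(p <- s') ball p.
  rewrite -!bigcup_seq => y [p' /= p's yp'].
  have [p'p|] := pselect (ball p' `&` ball p = set0).
    by right; exists p' => //=; rewrite mem_filter p's andbT; apply/asboolP.
  move=> /eqP/set0P[z [zp' zp]]; left; have := pmax _ p's.
  move: yp' zp' zp; rewrite /eball/= => yp' zp' zp.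
  have h1 := ler_edistD p'.1 y p.1; have h2 := ler_edistD z p'.1 p.1.
  by move: zp'; rewrite edistC => zp'; lra.
have mI := measurable_bigsetU_ball.
apply: (@le_trans _ _ (a%:E * (mu (eball p.1 (3 * p.2)) +
    mu (\big[setU/set0]_(p <- s') ball p)))).
  apply: lee_wpmul2l; first by rewrite lee_fin.
  apply: le_trans (outer_measureU2 (@lebesgue_outer R d) _ _).
  exact: le_lebesgue_outer.
rewrite muleDr//; last by rewrite ge0_adde_def// inE measure_ge0.
have -> : U = ball p `|` (U `\` ball p) by rewrite setDUK.
have mp := measurable_eball p.1 p.2.
rewrite ge0_integral_setU//; last 3 first.
- exact: measurableD.
- exact: measurable_funTS.
- by rewrite disj_set2E setDIK.
rewrite muleDr//; last first.
  by rewrite ge0_adde_def// inE; apply: integral_ge0.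
apply: leeD.
  rewrite lebesgue_eball ?mulr_gt0//.
  apply: (@le_trans _ _ ((3 ^+ d)%:E * (a%:E * mu (ball p)))).
    by rewrite (lebesgue_eball p.1)// exprMn EFinM -muleA muleCA.
  by apply: lee_wpmul2l => //; rewrite lee_fin exprn_ge0.
apply: IH.
(* The selected ball is nonempty, hence meets itself and is filtered out: the list gets strictly
   shorter. *)
- rewrite -ltnS; apply: leq_ltn_trans sn; rewrite size_filter.
  rewrite -(count_predC (fun p' => `[< ball p' `&` ball p = set0 >]) s).
  rewrite -addn1 leq_add2l -has_count; apply/hasP; exists p => //=.
  apply/asboolPn; rewrite setIid => pp0.
  by have := eball_center p.1 p0; rewrite pp0.
- exact: measurableD.
- move=> p'; rewrite mem_filter => /andP[/asboolP p'p /sU[? p'U ?]]; split => //.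
  move=> y yp'; split; first exact: p'U.
  by move=> yp; have : (ball p' `&` ball p) y by []; rewrite p'p.
Qed.

End ball_integrals.

Definition unit_ball_volume (R : realType) (d : nat) : R :=
  fine (lebesgue (eball (0 : 'rV[R]_d) 1)).

(** * Weak type (1,1) bound for an uncentred maximal function *)

Section maximal_weak_type.
Context {R : realType} {d : nat}.
Implicit Types x y z : 'rV[R]_d.
Local Notation mu := (@lebesgue R d).
Local Notation kappa := (unit_ball_volume R d).
Local Open Scope ereal_scope.

Lemma mu_eballE x (r : R) : (0 < r)%R -> mu (eball x r) = (r ^+ d * kappa)%:E.
Proof.
move=> r0; rewrite lebesgue_eball// EFinM fineK// ge0_fin_numE ?measure_ge0//.
exact: lebesgue_eball_lty.
Qed.

Hypothesis kappa0 : (0 < kappa)%R.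

Lemma inv_mu_eball x (r : R) : (0 < r)%R ->
  (mu (eball x r))^-1 = ((r ^+ d * kappa)^-1)%:E.
Proof. by move=> r0; rewrite mu_eballE// inver gt_eqF// mulr_gt0// exprn_gt0. Qed.

Lemma lt_average_eball (f : 'rV[R]_d -> \bar R) (a : R) x (r : R) : (0 < r)%R ->
  (a%:E < average f (eball x r)) = (a%:E * mu (eball x r) < \int[mu]_(y in eball x r) f y).
Proof.
move=> r0; rewrite /average (inv_mu_eball _ r0) (mu_eballE _ r0).
by rewrite [X in _ = (X < _)]muleC lte_pdivlMl// mulr_gt0 ?exprn_gt0.
Qed.

Variable f : 'rV[R]_d -> \bar R.
Hypothesis mf : measurable_fun [set: euclid R d] f.
Hypothesis f0 : forall x, 0 <= f x.
Variable U : set 'rV[R]_d.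
Hypothesis mU : measurable (U : set (euclid R d)).

Lemma average_ge0 B : 0 <= average f B.
Proof. by rewrite mule_ge0 ?inve_ge0 ?measure_ge0 ?integral_ge0. Qed.

Definition admissible (q : 'rV[rat]_d * rat) : Prop :=
  (0 < ratr q.2 :> R)%R /\ (rat_ball q : set 'rV[R]_d) `<=` U.

(* Restricting to rational balls makes the superlevel sets countable unions of
   balls, to which the finite covering argument passes in the limit. *)
Definition rat_maximal x : \bar R :=
  ereal_sup [set if `[< admissible q /\ rat_ball q x >] then average f (rat_ball q) else 0
            | q in [set: 'rV[rat]_d * rat]].

Lemma rat_maximal_ge0 x : 0 <= rat_maximal x.
Proof.
apply: (@le_trans _ _ (if `[< admissible (0%R, 0%R) /\ rat_ball (0%R, 0%R) x >]
  then average f (rat_ball (0%R, 0%R)) else 0)).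
  by case: ifP => // _; exact: average_ge0.
by apply: ereal_sup_ubound; exists (0%R, 0%R).
Qed.

Lemma rat_maximal_gtP (a : R) x : (0 <= a)%R -> a%:E < rat_maximal x ->
  exists q, [/\ admissible q, rat_ball q x & a%:E < average f (rat_ball q)].
Proof.
move=> a0 /ereal_sup_gt[_ [q _ <-]]; case: asboolP => [[? ?] ?|_].
  by exists q.
by rewrite lte_fin ltNge a0.
Qed.

Lemma rat_maximal_ge q x : admissible q -> rat_ball q x ->
  average f (rat_ball q) <= rat_maximal x.
Proof.
move=> aq qx; apply: ereal_sup_ubound; exists q => //=.
by case: asboolP => // -[].
Qed.

Lemma measurable_rat_maximal : measurable_fun [set: euclid R d] rat_maximal.
Proof.
apply: eopen_measurable_fun => a x /= ax; have [a0|a0] := ltP a 0%R.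
  exists 1%R => // y _ /=; apply: lt_le_trans (rat_maximal_ge0 y).
  by rewrite lte_fin.
have [q [aq qx aav]] := rat_maximal_gtP a0 ax.
have [e e0 eq] := eopen_eball qx; exists e => // y /eq qy /=.
exact: lt_le_trans aav (rat_maximal_ge aq qy).
Qed.

Lemma rat_maximal_weak_type (a : R) : (0 < a)%R ->
  a%:E * mu [set x | a%:E < rat_maximal x] <= (3 ^+ d)%:E * \int[mu]_(y in U) f y.
Proof.
move=> a0; pose P q := admissible q /\ a%:E < average f (rat_ball q).
(* [sel k] decodes [k] and keeps the ball when it is admissible with average above [a]; the unions
   [E n] over codes below [n] increase to the superlevel set. *)
pose sel k : option ('rV[R]_d * R) := obind (fun q : 'rV[rat]_d * rat =>
  if `[< P q >] then Some (map_mx ratr q.1, ratr q.2) else None) (unpickle k).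
pose s n := pmap sel (iota 0 n).
pose E n : set (euclid R d) := \big[setU/set0]_(p <- s n) eball p.1 p.2.
have mE n : measurable (E n) by exact: measurable_bigsetU_ball.
have sP n p : p \in s n -> exists2 q, P q & p = (map_mx ratr q.1, ratr q.2).
  rewrite mem_pmap => /mapP[k _]; rewrite /sel; case: unpickle => //= q.
  by case: asboolP => // Pq [->]; exists q.
have EU : [set x | a%:E < rat_maximal x] = \bigcup_n E n.
  apply/seteqP; split => x /=.
    move=> /(rat_maximal_gtP (ltW a0))[q [aq qx aav]].
    exists (pickle q).+1 => //; rewrite /E -bigcup_seq.
    exists (map_mx ratr q.1, ratr q.2) => //=.
    rewrite mem_pmap; apply/mapP; exists (pickle q).
      by rewrite mem_iota add0n ltnSn.
    by rewrite /sel pickleK /=; case: asboolP => // -[].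
  move=> [n _]; rewrite /E -bigcup_seq => -[p /= /sP[q [aq aav] ->] qx].
  exact: lt_le_trans aav (rat_maximal_ge aq qx).
have cvg : mu (E n) @[n --> \oo] --> mu (\bigcup_n E n).
  apply: nondecreasing_cvg_mu => //; first exact: bigcupT_measurable.
  move=> m n mn; apply/subsetPset; rewrite /E -!bigcup_seq.
  apply: bigcup_subset => p /=; rewrite !mem_pmap => /mapP[k].
  rewrite mem_iota => /andP[_ km] ->; apply: map_f.
  by rewrite mem_iota add0n (leq_trans km).
have bound n : mu (E n) <= (a^-1)%:E * ((3 ^+ d)%:E * \int[mu]_(y in U) f y).
  rewrite lee_pdivlMl//; apply: vitali_weak_type => //; first exact: ltW.
  move=> p /sP[q [[q0 qU] aav] ->] /=; split => //.
  by move: aav; rewrite lt_average_eball// => /ltW.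
rewrite EU -lee_pdivlMl// -(cvg_lim _ cvg)//; apply: lime_le.
  by apply/cvg_ex; eexists; exact: cvg.
by apply: nearW => n; exact: bound.
Qed.

End maximal_weak_type.

(** * Kolmogorov's inequality on a general measure space *)

Section kolmogorov.
Context {R : realType} d (T : measurableType d) (mu : {measure set T -> \bar R}).
Local Open Scope ereal_scope.

(* [F^delta <= A^delta + sum_k (2^(k+1) A)^delta 1_{F > 2^k A}] pointwise, and
   the series converges after integration since [delta < 1]. *)
Lemma kolmogorov_inequality_pos (delta K A m : R) (B : set T) (F : T -> \bar R) :
  (0 < delta < 1)%R -> (0 <= K)%R -> (0 < A)%R -> measurable B -> mu B = m%:E ->
  measurable_fun [set: T] F -> (forall x, 0 <= F x) ->
  (forall a, (0 < a)%R -> a%:E * mu [set x | a%:E < F x] <= (K * A * m)%:E) ->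
  \int[mu]_(x in B) F x `^ delta <=
    ((1 + K * 2 `^ delta / (1 - 2 `^ (delta - 1))) * A `^ delta * m)%:E.
Proof.
move=> /andP[delta0 delta1] K0 A0 mB muB mF F0 weak.
pose E k : set T := [set x | (2 ^+ k * A)%:E < F x].
have kA k : (0 < 2 ^+ k * A)%R by rewrite mulr_gt0 ?exprn_gt0.
have mE k : measurable (E k).
  by have := emeasurable_fun_o_infty measurableT mF (2 ^+ k * A)%:E; rewrite setTI.
pose c k := ((2 ^+ k.+1 * A) `^ delta)%R.
have exp2_ge (M : R) : exists n, (M <= 2 ^+ n * A)%R.
  have [n hn] : exists n : nat, (`|M| / A < n%:R)%R.
    by exists (Num.bound (`|M| / A)); apply: archi_boundP; rewrite divr_ge0 ?normr_ge0 ?ltW.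
  exists n; apply: le_trans (ler_norm M) _; rewrite -ler_pdivrMr//.
  apply: (le_trans (ltW hn)); by rewrite -natrX ler_nat ltnW// ltn_expl.
have c0 k : (0 <= c k)%R by exact: powR_ge0.
pose t k x := (c k * \1_(E k) x)%:E.
have t0 k x : 0 <= t k x by rewrite lee_fin mulr_ge0.
have mt k : measurable_fun [set: T] (t k).
  apply/measurable_EFinP; apply: measurable_funM => //; exact: measurable_indic.
have pointwise x : F x `^ delta <= (A `^ delta)%:E + \sum_(k <oo) t k x.
  have sum0 : 0 <= \sum_(k <oo) t k x by apply: nneseries_ge0.
  have tle k : t k x <= \sum_(k <oo) t k x.
    rewrite (@nneseriesD1 _ _ k)//= leeDl//; exact: nneseries_ge0.
  have [FA|AF] := leP (F x) A%:E.
    apply: (@le_trans _ _ (A `^ delta)%:E); last by rewrite leeDl.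
    rewrite -poweR_EFin; apply: gt0_ler_poweR => //; rewrite ?ltW// ?in_itv/= ?F0 ?leey//.
    by rewrite lee_fin ltW.
  apply: (@le_trans _ _ (\sum_(k <oo) t k x)); last first.
    by rewrite leeDr// lee_fin powR_ge0.
  have tE k : (2 ^+ k * A)%:E < F x -> t k x = (c k)%:E.
    by move=> h; rewrite /t indicE mem_set// mulr1.
  (* Where [F] is infinite every [t k] equals [c k], and these coefficients are unbounded, so the
     series is infinite too. *)
  case FE : (F x) AF => [u| |] // AF; last first.
    rewrite poweRyr ?gt_eqF// leye_eq; apply/eqP/eq_infty => s.
    have [n sn] : exists n, (s <= c n)%R.
      have [n hn] := exp2_ge ((Num.max s 0) `^ delta^-1)%R; exists n.
      apply: (@le_trans _ _ (Num.max s 0)%R); first by rewrite le_max lexx.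
      rewrite -[leLHS](@powRr1 _ (Num.max s 0)%R) ?le_max ?lexx ?orbT//.
      rewrite -(@mulVf _ delta) ?gt_eqF// powRrM.
      apply: ge0_ler_powR; rewrite ?nnegrE ?powR_ge0 ?ltW//.
      by rewrite (le_lt_trans hn)// ltr_pM2r// ltr_eXn2l ?ltr1n.
    by apply: le_trans (tle n); rewrite tE ?FE ?ltry// lee_fin.
  (* The dyadic layer of [u] ends at the least [n] with [u <= 2^n A]; this [n] is positive because
     [A < u]. *)
  have [k /andP[k1 k2]] : exists k, (2 ^+ k * A < u <= 2 ^+ k.+1 * A)%R.
    have [N uN] := exp2_ge u; have ex : exists n, (u <= 2 ^+ n * A)%R by exists N.
    case: (ex_minnP ex) => -[|k] uk kmin.
      by move: AF; rewrite lte_fin ltNge -[A]mul1r -(expr0 2) uk.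
    exists k; rewrite uk andbT ltNge; apply/negP => /kmin.
    by rewrite ltnn.
  apply: le_trans (tle k); rewrite tE ?FE ?lte_fin// poweR_EFin lee_fin /c.
  apply: ge0_ler_powR; [exact: ltW| | |exact: k2]; rewrite nnegrE ltW//.
  exact: lt_trans k1.
have mFd : measurable_fun [set: T] (fun x => F x `^ delta).
  exact: (measurableT_comp (measurable_poweR delta)).
set z := (2 `^ (delta - 1))%R.
have z0 : (0 <= z)%R by exact: powR_ge0.
(* Here [delta < 1] enters: [z] is the ratio of the dominating geometric series. *)
have z1 : (z < 1)%R.
  rewrite /z -opprB powRN invf_lt1 ?powR_gt0//.
  apply: (@le_lt_trans _ _ (1 `^ (1 - delta))%R); first by rewrite powR1.
  by apply: gt0_ltr_powR; rewrite ?subr_gt0 ?nnegrE ?ltr1n.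
have mS : measurable_fun B (fun x => \sum_(k <oo) t k x).
  apply: ge0_emeasurable_sum => // k _; exact: measurable_funTS.
apply: (@le_trans _ _ (\int[mu]_(x in B) ((A `^ delta)%:E + \sum_(k <oo) t k x))).
  apply: ge0_le_integral => //.
  - by move=> x _; exact: poweR_ge0.
  - exact: measurable_funTS.
  - by apply: emeasurable_funD.
rewrite ge0_integralD//; last 2 first.
- by move=> x _; rewrite lee_fin powR_ge0.
- by move=> x _; apply: nneseries_ge0.
rewrite integral_cst// muB integral_nneseries//; last first.
  by move=> n; exact: measurable_funTS.
have m0 : (0 <= m)%R by rewrite -lee_fin -muB measure_ge0.
pose M := (K * 2 `^ delta * A `^ delta * m)%R.
have M0 : (0 <= M)%R by rewrite !mulr_ge0 ?powR_ge0.
(* The weak type bound at height [2^k A] gains [2^-k], against the growth [2^(k delta)] of [c k]. *)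
have tk k : \int[mu]_(x in B) t k x <= (M * z ^+ k)%:E.
  rewrite /t; under eq_integral do rewrite EFinM.
  rewrite ge0_integralZl_EFin//; last first.
    by apply/measurable_EFinP; apply: measurable_funTS; exact: measurable_indic.
  rewrite integral_indic//.
  apply: (@le_trans _ _ ((c k)%:E * mu (E k))).
    apply: lee_wpmul2l; first by rewrite lee_fin.
    by apply: le_measure; rewrite ?inE//; exact: measurableI.
  apply: (@le_trans _ _ ((c k)%:E * ((2 ^+ k * A)^-1%:E * (K * A * m)%:E))).
    apply: lee_wpmul2l; first by rewrite lee_fin.
    by rewrite lee_pdivlMl//; exact: weak.
  rewrite -!EFinM lee_fin /M le_eqVlt; apply/orP; left; apply/eqP.
  have -> : ((2 ^+ k * A)^-1 * (K * A * m) = (2 ^+ k)^-1 * (K * m))%R.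
    by rewrite invfM -!mulrA; congr (_ * _)%R; rewrite mulrCA mulKf ?gt_eqF.
  have -> : c k = (2 `^ delta * (2 `^ delta) ^+ k * A `^ delta)%R.
    rewrite /c powRM ?exprn_ge0 ?(ltW A0)//; congr (_ * _)%R.
    by rewrite -exprS -(@powR_mulrn _ 2)// powRAC powR_mulrn// powR_ge0.
  have -> : z = (2 `^ delta * 2^-1)%R by rewrite /z powRB ?powRr1// pnatr_eq0 implybT.
  rewrite exprMn exprVn; lra.
rewrite -[leRHS]/((_ * _ * _)%:E) !mulrDl mul1r EFinD; apply: leeD => //.
apply: lime_le; first by apply: is_cvg_nneseries => n _ _; exact: integral_ge0.
apply: nearW => n.
apply: (@le_trans _ _ (\sum_(0 <= k < n) (M * z ^+ k)%:E)).
  by apply: lee_sum => k _; exact: tk.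
rewrite sumEFin lee_fin.
have := geometric_seriesE M (negbT (lt_eqF z1)) => /(congr1 (fun u => u n)) /=.
rewrite /series/= => ->.
have -> : (K * 2 `^ delta / (1 - z) * A `^ delta * m = M / (1 - z))%R.
  by rewrite /M; lra.
rewrite ler_pM2r ?invr_gt0 ?subr_gt0// ler_piMr// gerBl exprn_ge0//.
Qed.
(** For [A = 0] the weak type hypothesis also holds with any [t > 0] in place of [A]; the conclusion
    follows by letting [t] tend to [0]. *)
Lemma kolmogorov_inequality (delta K A m : R) (B : set T) (F : T -> \bar R) :
  (0 < delta < 1)%R -> (0 <= K)%R -> (0 <= A)%R -> measurable B -> mu B = m%:E ->
  measurable_fun [set: T] F -> (forall x, 0 <= F x) ->
  (forall a, (0 < a)%R -> a%:E * mu [set x | a%:E < F x] <= (K * A * m)%:E) ->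
  \int[mu]_(x in B) F x `^ delta <=
    ((1 + K * 2 `^ delta / (1 - 2 `^ (delta - 1))) * A `^ delta * m)%:E.
Proof.
move=> delta01 K0; rewrite le_eqVlt => /orP[/eqP <-|]; last first.
  exact: kolmogorov_inequality_pos.
move=> mB muB mF F0 weak; have /andP[delta0 delta1] := delta01.
set c := (1 + _)%R; have m0 : (0 <= m)%R by rewrite -lee_fin -muB measure_ge0.
have c0 : (0 <= c)%R.
  rewrite addr_ge0// divr_ge0 ?mulr_ge0 ?powR_ge0// subr_ge0.
  rewrite -[leRHS](powRr0 2); apply: ler_powR; first by rewrite ler1n.
  by rewrite subr_le0 ltW.
apply/lee_addgt0Pr => e e0; have cm0 : (0 < c * m + 1)%R by rewrite ltr_wpDl ?mulr_ge0.
(* Chosen so that [c t^delta m <= e]; the summand [1] covers the case [c * m = 0]. *)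
pose t := ((e / (c * m + 1)) `^ delta^-1)%R.
have t0 : (0 < t)%R by rewrite powR_gt0 ?divr_gt0.
have weakt a : (0 < a)%R -> a%:E * mu [set x | a%:E < F x] <= (K * t * m)%:E.
  move=> a0; apply: (le_trans (weak a a0)); rewrite mulr0 mul0r lee_fin.
  by rewrite !mulr_ge0// ltW.
apply: (le_trans (kolmogorov_inequality_pos delta01 K0 t0 mB muB mF F0 weakt)).
rewrite -/c powR0 ?gt_eqF// mulr0 mul0r add0e lee_fin.
have -> : (t `^ delta = e / (c * m + 1))%R.
  by rewrite -powRrM mulVf ?gt_eqF// powRr1// divr_ge0 ?ltW.
rewrite mulrAC mulrA ler_pdivrMr// mulrC; apply: ler_wpM2l; first exact: ltW.
by rewrite lerDl.
Qed.

End kolmogorov.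

(** * Reverse Hoelder inequality *)

Section local_integrability.
Context {R : realType} {d : nat}.
Implicit Types x y z : 'rV[R]_d.
Local Notation mu := (@lebesgue R d).
Local Open Scope ereal_scope.

(** Local integrability is stated on compact sets; the closed cube around the ball is compact, and
    measurable because its complement is open. *)
Lemma eball_compact x (r : R) : exists K : set 'rV[R]_d,
  [/\ compact K, measurable (K : set (euclid R d)) & eball x r `<=` K].
Proof.
pose A i := `[(x ord0 i - r)%R, (x ord0 i + r)%R]%classic.
exists [set v : 'rV[R]_d | forall i, A i (v ord0 i)]; split.
- apply: (@rV_compact R _ A) => i; exact: segment_compact.
- rewrite -[X in measurable X]setCK; apply: measurableC; apply: measurable_eopen.
  move=> y /= /existsNP[i]; rewrite /A/= in_itv/= => /negP.
  rewrite negb_and -!ltNge => /orP[yi|yi].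
  + exists (x ord0 i - r - y ord0 i)%R; first by rewrite subr_gt0.
    move=> z; rewrite /eball/= => /(le_lt_trans (ler_coord_enorm (z - y)%R i)).
    rewrite !mxE ltr_norml => /andP[h1 h2] /(_ i); rewrite in_itv/= => /andP[h3 h4].
    lra.
  + exists (y ord0 i - (x ord0 i + r))%R; first by rewrite subr_gt0.
    move=> z; rewrite /eball/= => /(le_lt_trans (ler_coord_enorm (z - y)%R i)).
    rewrite !mxE ltr_norml => /andP[h1 h2] /(_ i); rewrite in_itv/= => /andP[h3 h4].
    lra.
- move=> y; rewrite /eball/= => yr i; rewrite /A/= in_itv/=.
  have := le_lt_trans (ler_coord_enorm (y - x)%R i) yr; rewrite !mxE ltr_norml.
  by move=> /andP[? ?]; apply/andP; split; lra.
Qed.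

Lemma L1loc_measurable (f : 'rV[R]_d -> R) : L1loc f ->
  measurable_fun [set: euclid R d] (fun x => `|f x|%:E).
Proof. by move=> [mf _]; apply/measurable_EFinP; exact: measurableT_comp. Qed.

Lemma L1loc_ball_lty (f : 'rV[R]_d -> R) x (r : R) : L1loc f ->
  \int[mu]_(y in eball x r) `|f y|%:E < +oo.
Proof.
move=> /[dup] lf [mf fK].
have [K [cK mK rK]] := eball_compact x r; apply: le_lt_trans (fK _ cK).
apply: ge0_subset_integral => //; first exact: measurable_eball.
by apply: measurable_funTS; exact: L1loc_measurable.
Qed.
End local_integrability.

(** * Decay and doubling of the mass of [V] on balls *)

Section reverse_holder_consequences.
Context {R : realType} {d : nat}.
Implicit Types x y z : 'rV[R]_d.
Local Notation mu := (@lebesgue R d).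
Local Notation kappa := (unit_ball_volume R d).
Hypothesis kappa0 : (0 < kappa)%R.
Hypothesis d0 : (0 < d)%N.
Variables (q : R) (V : 'rV[R]_d -> R).
Hypothesis q1 : 1 < q.
Hypothesis hV : reverse_holder q V.

Let V0 x : 0 <= V x. Proof. by have [] := hV. Qed.
Let mV : measurable_fun [set: euclid R d] V. Proof. by have [_ []] := hV. Qed.
Let mVE : measurable_fun [set: euclid R d] (EFin \o V).
Proof. exact/measurable_EFinP. Qed.
Let V0E x : (0 <= (V x)%:E)%E. Proof. by rewrite lee_fin. Qed.

Definition ball_mass x (r : R) : R := fine (\int[mu]_(y in eball x r) (V y)%:E)%E.

Lemma ball_massE x r : (\int[mu]_(y in eball x r) (V y)%:E)%E = (ball_mass x r)%:E.
Proof.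
rewrite /ball_mass fineK// ge0_fin_numE; last by apply: integral_ge0 => ? _.
have [_ lV _] := hV; have := L1loc_ball_lty x r lV.
by under eq_integral do rewrite ger0_norm//.
Qed.

Lemma ball_mass_ge0 x r : 0 <= ball_mass x r.
Proof. by rewrite fine_ge0//; apply: integral_ge0 => ? _. Qed.

Lemma le_ball_mass x r y s : enorm (x - y) + r <= s -> ball_mass x r <= ball_mass y s.
Proof.
move=> h; rewrite -lee_fin -!ball_massE; apply: (le_ball_integral mVE V0E).
  exact: measurable_eball.
exact: eball_sub.
Qed.

Lemma reverse_holder_real : exists2 C : R, 0 <= C & forall x (r : R), 0 < r ->
  (\int[mu]_(y in eball x r) (V y `^ q)%:E <=
   (C * (ball_mass x r / (r ^+ d * kappa)) `^ q * (r ^+ d * kappa))%:E)%E.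
Proof.
(* The given constant may be negative; truncation at [0] allows raising it to the power [q]. *)
have [_ _ [C hC]] := hV; pose C' := Num.max 0 C.
have C'0 : 0 <= C' by rewrite le_max lexx.
exists (C' `^ q); first exact: powR_ge0.
move=> x r r0; have b0 : 0 < r ^+ d * kappa by rewrite mulr_gt0 ?exprn_gt0.
have q0 : q != 0 by rewrite gt_eqF// (lt_trans ltr01).
have := hC x r r0; rewrite /average (inv_mu_eball kappa0 _ r0) ball_massE.
set I := (X in ((_ * X) `^ _ <= _)%E); rewrite -EFinM => h.
have I0 : (0 <= I)%E by apply: integral_ge0 => y _; rewrite lee_fin powR_ge0.
have aI0 : (0 <= (r ^+ d * kappa)^-1%:E * I)%E.
  by rewrite mule_ge0// lee_fin invr_ge0 ltW.
have h' : (((r ^+ d * kappa)^-1%:E * I) `^ q^-1 <=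
    (C' * (ball_mass x r / (r ^+ d * kappa)))%:E)%E.
  apply: (le_trans h); rewrite lee_fin [_^-1 * _]mulrC.
  apply: ler_wpM2r; first by rewrite divr_ge0 ?ball_mass_ge0 ?ltW.
  by rewrite le_max lexx orbT.
have : ((r ^+ d * kappa)^-1%:E * I <=
    ((C' * (ball_mass x r / (r ^+ d * kappa))) `^ q)%:E)%E.
  rewrite -[leLHS]poweRe1// -(mulVf q0) poweRrM -poweR_EFin.
  apply: gt0_ler_poweR => //; first by rewrite (le_trans ler01)// ltW.
  - by rewrite in_itv/= poweR_ge0 leey.
  - rewrite in_itv/= leey andbT lee_fin mulr_ge0// divr_ge0 ?ball_mass_ge0//.
    exact: ltW.
rewrite lee_pdivrMl// => /le_trans; apply.
rewrite -EFinM lee_fin (@powRM _ C')//; first by rewrite mulrC.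
by rewrite divr_ge0 ?ball_mass_ge0 ?(ltW b0).
Qed.

(* Young in the form [V <= a + V^q a^(1-q)], at the level [a = N avg_B V]. *)
Lemma reverse_holder_subset : exists2 K : R, 0 <= K & forall x (r e N : R) (E : set 'rV[R]_d), 0 < r -> 0 < N ->
  measurable (E : set (euclid R d)) -> E `<=` eball x r ->
  (mu E = (e * (r ^+ d * kappa))%:E)%E ->
  (\int[mu]_(y in E) (V y)%:E <= ((N * e + N `^ (1 - q) * K) * ball_mass x r)%:E)%E.
Proof.
have [C C0 hC] := reverse_holder_real; exists C => // x r e N E r0 N0 mE Er muE.
have b0 : 0 < r ^+ d * kappa by rewrite mulr_gt0 ?exprn_gt0.
have mB := measurable_eball x r.
(* Zero mass is treated apart, because the level [N * A] used below must be positive. *)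
have [A0|] := leP (ball_mass x r) 0.
  have -> : ball_mass x r = 0 by apply/eqP; rewrite eq_le A0 ball_mass_ge0.
  rewrite mulr0; apply: le_trans (_ : ((ball_mass x r)%:E <= 0)%E); last by rewrite lee_fin.
  by rewrite -ball_massE; apply: (le_ball_integral mVE V0E).
move=> v0; pose A := ball_mass x r / (r ^+ d * kappa).
have A0 : 0 < A by rewrite divr_gt0.
have NA0 : 0 < N * A by rewrite mulr_gt0.
have q0 : 0 <= q by rewrite (le_trans ler01)// ltW.
have mVq : measurable_fun [set: euclid R d] (fun y => (V y `^ q)%:E).
  apply/measurable_EFinP.
  exact: (measurableT_comp (measurable_powR q)).
have young y : V y <= N * A + (N * A) `^ (1 - q) * V y `^ q.
  have [Va|aV] := leP (V y) (N * A).
    by rewrite (le_trans Va)// lerDl mulr_ge0 ?powR_ge0.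
  have Vy0 : 0 < V y by exact: lt_trans aV.
  apply: (@le_trans _ _ ((N * A) `^ (1 - q) * V y `^ q)); last by rewrite lerDr ltW.
  rewrite -[leLHS]powRr1// -[in leLHS](subrK q 1) powRD; last first.
    by apply/implyP => _; rewrite gt_eqF.
  apply: ler_wpM2r; first exact: powR_ge0.
  rewrite -opprB !powRN lef_pV2 ?posrE ?powR_gt0//.
  by apply: ge0_ler_powR; rewrite ?subr_ge0 ?nnegrE ?ltW.
apply: (@le_trans _ _ (\int[mu]_(y in E)
    ((N * A)%:E + ((N * A) `^ (1 - q))%:E * (V y `^ q)%:E))%E).
  apply: ge0_le_integral; first exact: mE.
  - by move=> y _; exact: V0E.
  - exact: measurable_funTS.
  - apply: emeasurable_funD; first exact: measurable_cst.
    by apply: measurable_funeM; exact: measurable_funTS.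
  - by move=> y _; rewrite -EFinM -EFinD lee_fin young.
rewrite ge0_integralD; last 5 first.
- exact: mE.
- by move=> y _; rewrite lee_fin ltW.
- exact: measurable_cst.
- by move=> y _; rewrite -EFinM lee_fin mulr_ge0 ?powR_ge0.
- by apply: measurable_funeM; exact: measurable_funTS.
rewrite integral_cst; last exact: mE.
rewrite [X in ((N * A)%:E * X + _)%E]muE ge0_integralZl_EFin; last 4 first.
- exact: mE.
- by move=> y _; rewrite lee_fin powR_ge0.
- exact: measurable_funTS.
- exact: powR_ge0.
apply: (@le_trans _ _ ((N * A)%:E * (e * (r ^+ d * kappa))%:E +
   ((N * A) `^ (1 - q))%:E * (C * A `^ q * (r ^+ d * kappa))%:E)%E).
  apply: leeD => //; apply: lee_wpmul2l; first by rewrite lee_fin powR_ge0.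
  apply: le_trans (hC x r r0).
  apply: (le_ball_integral mVq) => // y; by rewrite lee_fin powR_ge0.
rewrite -!EFinM -EFinD lee_fin le_eqVlt; apply/orP; left; apply/eqP.
rewrite powRM ?ltW//.
have -> : ball_mass x r = A * (r ^+ d * kappa) by rewrite divfK ?gt_eqF.
have -> : A `^ q = A / A `^ (1 - q).
  rewrite -powRN opprB -[X in _ = X * _](powRr1 (ltW A0)) -powRD.
    by rewrite addrC subrK.
  by apply/implyP => _; rewrite gt_eqF.
have a0 : A `^ (1 - q) != 0 by rewrite gt_eqF ?powR_gt0.
set w := A `^ (1 - q) in a0 *.
rewrite (_ : N `^ (1 - q) * w * (C * (A / w) * (r ^+ d * kappa)) =
  N `^ (1 - q) * C * A * (r ^+ d * kappa) * (w / w)); last by lra.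
by rewrite divff//; lra.
Qed.

(** The subset bound is applied to [E = B(x,t)], of relative measure [s^d] with [s = t/T]. The
    choice [N = s^(-d/q)] balances its two terms: [N s^d] and [N^(1-q)] both equal [s^(d-d/q)]. *)
Lemma ball_mass_power : exists2 K : R, 1 <= K & forall x (t T : R), 0 < t <= T ->
  ball_mass x t <= K * (t / T) `^ (d%:R - d%:R / q) * ball_mass x T.
Proof.
have [K K0 hK] := reverse_holder_subset; exists (1 + K); first by rewrite lerDl.
move=> x t T /andP[t0 tT]; have T0 : 0 < T by exact: lt_le_trans tT.
have q0 : q != 0 by rewrite gt_eqF// (lt_trans ltr01).
pose s := t / T; have s0 : 0 < s by rewrite divr_gt0.
rewrite -lee_fin -ball_massE.
have E1 : (mu (eball x t) = (s ^+ d * (T ^+ d * kappa))%:E)%E.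
  by rewrite mu_eballE// mulrA -exprMn divfK ?gt_eqF.
have tTsub : eball x t `<=` eball x T by apply: eball_sub; rewrite subrr enorm0 add0r.
have N0 : 0 < s `^ (- (d%:R / q)) by rewrite powR_gt0.
apply: le_trans (hK x T _ _ _ T0 N0 (measurable_eball x t) tTsub E1) _.
rewrite lee_fin le_eqVlt; apply/orP; left; apply/eqP; congr (_ * _).
rewrite mulrDl mul1r -powR_mulrn ?ltW// -powRD; last first.
  by apply/implyP => _; rewrite gt_eqF.
rewrite -powRrM; congr (_ + _); first by rewrite addrC.
rewrite mulrC; congr (_ * _ `^ _).
rewrite mulrBr mulr1 mulNr divfK//; lra.
Qed.

(* For [l] close to [1], the shell [B(x,T) \ B(x,lT)] carries at most half of the
   mass of [B(x,T)]; iterating yields doubling. *)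
Lemma ball_mass_shrink : exists2 l : R, 0 < l < 1 &
  forall x (T : R), 0 < T -> ball_mass x T <= 2 * ball_mass x (l * T).
Proof.
have [K K0 hK] := reverse_holder_subset.
have q10 : 0 < q - 1 by rewrite subr_gt0.
(* [N] makes [N^(1-q) K] at most [1/4]. The shell of relative measure [1/(4N)], which determines [l]
   below, contributes another [1/4]. *)
pose N := (4 * (K + 1)) `^ (q - 1)^-1.
have K4 : 1 <= 4 * (K + 1) by lra.
have N1 : 1 <= N.
  rewrite -[leLHS](powRr0 (4 * (K + 1))); apply: ler_powR => //.
  by rewrite invr_ge0 ltW.
have N0 : 0 < N by exact: lt_le_trans N1.
have NK : N `^ (1 - q) * K <= 4^-1.
  rewrite /N -powRrM -(opprB q 1) mulrN mulVf ?gt_eqF// powR_inv1; last by lra.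
  by rewrite mulrC ler_pdivrMr; lra.
have N4 : 0 < 1 - (4 * N)^-1 < 1.
  rewrite subr_gt0 invf_lt1 ?mulr_gt0// gtrBl invr_gt0 mulr_gt0// andbT; lra.
pose l := (1 - (4 * N)^-1) `^ d%:R^-1.
have ld : l ^+ d = 1 - (4 * N)^-1.
  rewrite -powR_mulrn ?powR_ge0// -powRrM mulVf ?pnatr_eq0 -?lt0n// powRr1// ltW//.
  by case/andP: N4.
have l0 : 0 < l by rewrite powR_gt0//; case/andP: N4.
have l1 : l < 1.
  rewrite -(@ltr_pXn2r _ d)// ?nnegrE ?(ltW l0)// expr1n ld.
  by case/andP: N4.
exists l; first by rewrite l0.
move=> x T T0; have lT0 : 0 < l * T by rewrite mulr_gt0.
have lTT : eball x (l * T) `<=` eball x T.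
  by apply: eball_sub; rewrite subrr enorm0 add0r ger_pMl// ltW.
have mB := measurable_eball x T; have ml := measurable_eball x (l * T).
have E1 : (mu (eball x T `\` eball x (l * T)) = ((4 * N)^-1 * (T ^+ d * kappa))%:E)%E.
  transitivity (mu (eball x T) - mu (eball x (l * T)))%E.
    rewrite -[in RHS](setIidr lTT); apply: measureD => //.
    exact: lebesgue_eball_lty.
  rewrite !mu_eballE// -EFinB exprMn ld; congr EFin; lra.
have h2 := hK x T _ _ _ T0 N0 (measurableD mB ml) (@subDsetl _ _ _) E1.
have := ball_massE x T; rewrite -(setDUK lTT) ge0_integral_setU; last 5 first.
- exact: ml.
- exact: measurableD.
- exact: measurable_funTS.
- by move=> y _; exact: V0E.
- by rewrite disj_set2E setDIK.
rewrite ball_massE => h1.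
have : ((ball_mass x T)%:E <= (ball_mass x (l * T))%:E +
   ((N * (4 * N)^-1 + N `^ (1 - q) * K) * ball_mass x T)%:E)%E.
  by rewrite -h1; apply: leeD2l; apply: h2.
rewrite -EFinD lee_fin.
have -> : N / (4 * N) = 4^-1 by rewrite invfM mulrCA divff ?gt_eqF// mulr1.
have : N `^ (1 - q) * K * ball_mass x T <= 4^-1 * ball_mass x T.
  by apply: ler_wpM2r => //; exact: ball_mass_ge0.
lra.
Qed.

(** The exponent satisfies [l^m <= 1/2], so the factor [2] lost in passing from [T] to [l T] is paid
    for by the drop of [(T/t)^m]. The leading [2] pays for the last step, where [l T <= t]. The
    induction is on the number of contractions needed. *)
Lemma ball_mass_doubling : exists m : nat, forall x (t T : R), 0 < t <= T ->
  ball_mass x T <= 2 * (T / t) ^+ m * ball_mass x t.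
Proof.
have [l /andP[l0 l1] hl] := ball_mass_shrink.
have expl (e : R) : 0 < e -> exists n, l ^+ n <= e.
  move=> e0; have : \forall n \near \oo, `|0 - l ^+ n| < e.
    by apply: cvgr_dist_lt => //; apply: cvg_expr; rewrite ger0_norm// ltW.
  case=> n _ /(_ n (leqnn n)) /=; rewrite sub0r normrN ger0_norm ?exprn_ge0 ?ltW//.
  by move=> h; exists n; exact: ltW.
have [m lm] := expl 2^-1 ltac:(lra); exists m => x t T /andP[t0 tT].
have T0 : 0 < T by exact: lt_le_trans tT.
have [n ln] := expl (t / T) (divr_gt0 t0 T0).
have {ln} : l ^+ n * T <= t by rewrite -ler_pdivlMr.
elim: n T T0 tT => [|n IH] T T0 tT lnT.
  have -> : T = t by apply/eqP; rewrite eq_le tT andbT -[T]mul1r -(expr0 l).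
  rewrite divff ?gt_eqF// expr1n mulr1 ler_peMl ?ball_mass_ge0//; lra.
have Tt : 1 <= T / t by rewrite ler_pdivlMr ?mul1r.
have [lTt|tlT] := leP (l * T) t.
  apply: (le_trans (hl x T T0)); rewrite -mulrA; apply: ler_wpM2l => //.
  apply: (@le_trans _ _ (ball_mass x t)).
    by apply: le_ball_mass; rewrite subrr enorm0 add0r.
  by rewrite ler_peMl ?ball_mass_ge0// exprn_ege1.
have lT0 : 0 < l * T by rewrite mulr_gt0.
have := IH (l * T) lT0 (ltW tlT); rewrite mulrA -exprSr => /(_ lnT) h.
apply: (le_trans (hl x T T0)).
apply: (@le_trans _ _ (2 * (2 * (l * T / t) ^+ m * ball_mass x t))).
  by apply: ler_wpM2l.
rewrite -[l * T / t]mulrA exprMn; set w := (T / t) ^+ m * ball_mass x t.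
have w0 : 0 <= w by rewrite mulr_ge0 ?ball_mass_ge0// exprn_ge0// (le_trans ler01).
rewrite (_ : 2 * (2 * _ * _) = 2 * (2 * l ^+ m * w)); last by rewrite /w; lra.
rewrite -[leRHS]mulrA; apply: ler_wpM2l => //.
by apply: ler_piMl => //; lra.
Qed.

End reverse_holder_consequences.

(** * Critical radius *)

Section nontriviality.
Context {R : realType} {d : nat}.
Implicit Types x y z : 'rV[R]_d.
Local Notation mu := (@lebesgue R d).
Local Notation kappa := (unit_ball_volume R d).

Lemma bigcup_eball x : \bigcup_n eball x n.+1%:R = [set: 'rV[R]_d].
Proof.
apply/seteqP; split=> y // _.
exists (Num.bound (enorm (y - x))) => //; rewrite /eball/=.
apply: (@lt_trans _ _ (Num.bound (enorm (y - x)))%:R); last by rewrite ltr_nat.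
by apply: archi_boundP; exact: enorm_ge0.
Qed.

(* If the unit ball were null, the whole space would be null and every property
   would hold almost everywhere; this replaces a computation of the volume. *)
Lemma unit_ball_volume_gt0 (P : 'rV[R]_d -> Prop) :
  ~ {ae mu, forall x, P x} -> 0 < kappa.
Proof.
move=> nP; rewrite lt_neqAle fine_ge0 ?measure_ge0// andbT.
apply/negP => /eqP k0; apply: nP; exists setT; split => //.
rewrite -(bigcup_eball 0); apply/eqP.
have := @outer_measure_sigma_subadditive _ _ (@lebesgue_outer R d)
  (fun n => eball (0 : 'rV[R]_d) n.+1%:R).
rewrite eseries0 => [|n _ _]; last by apply: etrans (mu_eballE _ _) _ => //; rewrite -k0 mulr0.
by move=> h; rewrite eq_le h/= measure_ge0.
Qed.

(** Balls around [x] exhaust the space, so the total integral vanishes by monotone convergence. *)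
Lemma ae_eq0_of_ball_integrals (f : 'rV[R]_d -> \bar R) x :
  measurable_fun [set: euclid R d] f -> (forall y, 0 <= f y)%E ->
  (forall r : R, (0 < r)%R -> \int[mu]_(y in eball x r) f y = 0)%E ->
  {ae mu, forall y, f y = 0%E}.
Proof.
move=> mf f0 If.
have cvg : (\int[mu]_(y in eball x n.+1%:R) f y @[n --> \oo] -->
    \int[mu]_(y in [set: 'rV[R]_d]) f y)%E.
  rewrite -(bigcup_eball x); apply: ge0_nondecreasing_set_cvg_integral => //.
  - move=> m n mn; apply/subsetPset; apply: eball_sub.
    by rewrite subrr enorm0 add0r ler_nat.
  - by move=> n; exact: measurable_eball.
  - by move=> n; exact: measurable_funTS.
have I0 : (\int[mu]_(y in [set: 'rV[R]_d]) f y = 0)%E.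
  rewrite -(cvg_lim _ cvg)//; under eq_fun do rewrite If//.
  exact: lim_cst.
have : ae_eq mu [set: euclid R d] f (cst 0%E).
  apply/(ae_eq_integral_abs mu measurableT mf).
  by under eq_integral do rewrite gee0_abs//.
by apply: filterS => y /= h; apply: h.
Qed.

End nontriviality.

(* Exchanging [x] and [y] in the hypothesis also bounds [p] from above. *)
Lemma slowly_varying_comparison (R : realType) (d : nat) (p : 'rV[R]_d -> R) (c : R)
    (k : nat) : (forall x, 0 < p x) -> 0 < c <= 1 ->
  (forall x y, c * p x <= p y * (1 + enorm (x - y) / p x) ^+ k) ->
  exists2 C : R, 1 <= C & forall x (r : R) y z (s : R),
    0 < r -> 0 < s -> eball x r y -> eball x r z ->
    1 + 3 * s / p z <= C * (1 + r / p x) ^+ k.+1 * (1 + s / p y).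
Proof.
move=> p0 /andP[c0 c1] hk.
have pw (a b : R) : 0 <= a -> a <= b -> (1 + a) ^+ k <= (1 + b) ^+ k.
  by move=> a0 ab; apply: lerXn2r; rewrite ?nnegrE; lra.
have [C CE C1] : exists2 C : R, C = 2 ^+ k / c & 1 <= C.
  by eexists; [reflexivity | rewrite ler_pdivlMr// mul1r (le_trans c1)// exprn_ege1// ler1n].
exists (3 * C / c); first by rewrite ler_pdivlMr//; lra.
move=> x r y z s r0 s0 xy xz.
set u := 1 + r / p x.
have u1 : 1 <= u by rewrite /u lerDl divr_ge0 ?ltW.
have ru : r <= p x * u by rewrite /u mulrDr mulr1 mulrC divfK ?gt_eqF// lerDr ltW.
(* The hypothesis read from [x] to [z] keeps [p z] from being small. *)
have zx : c * p x <= p z * u ^+ k.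
  apply: le_trans (hk x z) _; apply: ler_wpM2l; first exact: ltW.
  apply: pw; first by rewrite divr_ge0 ?enorm_ge0 ?ltW.
  by rewrite ler_pM2r ?invr_gt0// edistC ltW.
(* If [p y <= r], then [r <= p x * u] suffices. Otherwise [y] is within [p y] of [x], and the
   exchanged hypothesis gives [c * p y <= 2^k * p x], whence [C = 2^k / c]. *)
have yx : p y <= C * (p x * u).
  have [yr|ry] := leP (p y) r.
    apply: (le_trans yr); apply: (le_trans ru); rewrite ler_peMl// mulr_ge0 ?(ltW (p0 x))//.
    by lra.
  rewrite CE mulrAC ler_pdivlMr// mulrC; apply: (le_trans (hk y x)).
  rewrite mulrC; apply: ler_pM; rewrite ?(ltW (p0 x))//.
  - by rewrite exprn_ge0// addr_ge0// divr_ge0 ?enorm_ge0// ltW.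
  - rewrite -[2]/(1 + 1); apply: pw; first by rewrite divr_ge0 ?enorm_ge0// ltW.
    by rewrite ler_pdivrMr// mul1r (le_trans _ (ltW ry))// ltW.
  - by rewrite ler_peMr// ltW.
have uk1 : 1 <= u ^+ k by rewrite exprn_ege1.
have iz : (p z)^-1 <= u ^+ k / (c * p x).
  rewrite ler_pdivlMr ?mulr_gt0// mulrC ler_pdivrMr//.
  by rewrite [leRHS]mulrC.
have ix : (p x)^-1 <= C * u / p y.
  by rewrite ler_pdivlMr// mulrC ler_pdivrMr// (le_trans yx)//; lra.
have h : 3 * s / p z <= 3 * C / c * u ^+ k.+1 * (s / p y).
  apply: (@le_trans _ _ (3 * s * (u ^+ k / c * (C * u / p y)))).
    apply: ler_wpM2l; first by lra.
    apply: (le_trans iz); rewrite invfM [leLHS]mulrA; apply: ler_wpM2l => //.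
    by rewrite divr_ge0 ?(ltW c0)//; lra.
  rewrite exprSr; lra.
have hC : 1 <= 3 * C / c by rewrite ler_pdivlMr//; lra.
have : 1 <= 3 * C / c * u ^+ k.+1.
  by rewrite -[leLHS]mulr1 ler_pM// exprn_ege1.
rewrite mulrDr mulr1 mulrA; move: h; rewrite mulrA; lra.
Qed.

Section critical_radius_comparison.
Context {R : realType} {d : nat}.
Implicit Types x y z : 'rV[R]_d.
Local Notation mu := (@lebesgue R d).
Local Notation kappa := (unit_ball_volume R d).
Hypothesis kappa0 : (0 < kappa)%R.
Hypothesis hd : (3 <= d)%N.
Variables (q : R) (V : 'rV[R]_d -> R).
Hypothesis hq : d%:R / 2 < q.
Hypothesis hV : reverse_holder q V.
Hypothesis hV0 : ~ {ae mu, forall x, V x = 0}.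
Local Notation v := (ball_mass V).

Let q1 : 1 < q.
Proof.
apply: lt_trans hq; rewrite ltr_pdivlMr// mul1r ltr_nat.
exact: leq_trans hd.
Qed.

Local Notation e := (2 - d%:R / q).

Let e0 : 0 < e.
Proof.
rewrite subr_gt0 ltr_pdivrMr ?(lt_trans ltr01)// mulrC -ltr_pdivrMr//.
Qed.

Let d0 : (0 < d)%N. Proof. exact: leq_trans hd. Qed.

Lemma critical_radiusE x : critical_radius V x =
  ereal_sup [set r%:E | r in [set r : R | 0 < r /\ v x r <= r ^+ (d - 2)]].
Proof.
congr ereal_sup; congr (image _ _); apply/seteqP; split => r /= [r0];
  rewrite (ball_massE hV) -EFinM lee_fin mulrC ler_pdivrMr ?mul1r ?exprn_gt0//;
  by split.
Qed.

(** Let [t = (K M)^(-1/e)]. Decay gives [v(x,Tt) <= K t^(d-2+e) M T^(d-2)], which is [(Tt)^(d-2)]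
    because [K M t^e = 1]: the radius [Tt] competes in the supremum. *)
Lemma critical_radius_ge : exists2 K : R, 1 <= K & forall x (T M : R), 0 < T -> 1 <= M ->
  v x T <= M * T ^+ (d - 2) ->
  ((T * (K * M) `^ (- e^-1))%:E <= critical_radius V x)%E.
Proof.
have [K K1 hK] := ball_mass_power kappa0 q1 hV.
exists K => // x T M T0 M1 vT; rewrite critical_radiusE.
have KM1 : 1 <= K * M by rewrite -[1]mulr1 ler_pM.
have KM0 : 0 < K * M by exact: lt_le_trans KM1.
have K0 : 0 < K by exact: lt_le_trans K1.
set t := (K * M) `^ (- e^-1).
have t0 : 0 < t by rewrite powR_gt0.
have t1 : t <= 1.
  rewrite -(powRr0 (K * M)) /t; apply: ler_powR => //.
  by rewrite oppr_le0 invr_ge0 ltW.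
apply: ereal_sup_ubound; exists (T * t) => //=; split; first by rewrite mulr_gt0.
have tT : 0 < T * t <= T by rewrite mulr_gt0//= ger_pMr.
apply: le_trans (hK x _ _ tT) _; rewrite [T * t / T]mulrAC divff ?gt_eqF// mul1r.
apply: (@le_trans _ _ (K * t `^ (d%:R - d%:R / q) * (M * T ^+ (d - 2)))).
  by apply: ler_wpM2l => //; rewrite mulr_ge0 ?powR_ge0// ltW.
have -> : d%:R - d%:R / q = (d - 2)%:R + e.
  by rewrite natrB ?(leq_trans _ hd)//; lra.
rewrite powRD; last by apply/implyP => _; rewrite gt_eqF.
rewrite powR_mulrn ?(ltW t0)// -[t `^ e]powRrM mulNr mulVf ?gt_eqF// powR_inv1 ?(ltW KM0)//.
rewrite exprMn le_eqVlt; apply/orP; left; apply/eqP.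
rewrite (_ : K * _ * _ = T ^+ (d - 2) * t ^+ (d - 2) * ((K * M) / (K * M))).
  by rewrite divff ?gt_eqF ?mulr1.
lra.
Qed.

(** Otherwise all balls around [x] have zero mass and [V] vanishes almost everywhere. *)
Lemma ball_mass_gt0 x : exists2 r, 0 < r & 0 < v x r.
Proof.
apply: contrapT => h; apply: hV0.
have V0 : forall y, 0 <= V y by have [] := hV.
have : {ae mu, forall y, (V y)%:E = 0%E}.
  apply: (@ae_eq0_of_ball_integrals _ _ _ x).
  - by apply/measurable_EFinP; have [_ []] := hV.
  - by move=> y; rewrite lee_fin.
  - move=> r r0; rewrite (ball_massE hV); congr EFin; apply/eqP.
    rewrite eq_le (ball_mass_ge0 hV) andbT leNgt; apply/negP => vr.
    by apply: h; exists r.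
by move=> [A [mA A0 sA]]; exists A; split => // y Vy; apply: sA => -[].
Qed.

(** Decay read from a fixed ball of positive mass outwards: [v(x,r)] is at most a constant times
    [T^-e], which bounds [T]. The value [M = 1] gives finiteness of [rho]; [M = 2] bounds the
    approximating radii in the proof that [rho] is measurable. *)
Lemma ball_mass_large x (M : R) : 0 <= M -> exists B : R, forall T, 0 < T ->
  v x T <= M * T ^+ (d - 2) -> T <= B.
Proof.
move=> M0; have [K K1 hK] := ball_mass_power kappa0 q1 hV.
have [r r0 vr] := ball_mass_gt0 x.
pose a := K * M * r `^ (d%:R - d%:R / q) / v x r.
exists (Num.max r (a `^ e^-1)) => T T0 vT.
have K0 : 0 < K by exact: lt_le_trans K1.
rewrite le_max; have [//|rT/=] := leP T r.
have rT' : 0 < r <= T by rewrite r0 ltW.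
have := hK x _ _ rT'; move=> /le_trans h.
have {h} : v x r <= K * (r / T) `^ (d%:R - d%:R / q) * (M * T ^+ (d - 2)).
  by apply: h; apply: ler_wpM2l => //; rewrite mulr_ge0 ?powR_ge0// ltW.
rewrite powRM ?invr_ge0 ?(ltW r0) ?(ltW T0)// -(@powR_inv1 _ T) ?(ltW T0)// -powRrM mulN1r.
have -> : T ^+ (d - 2) = T `^ (d%:R - d%:R / q) * T `^ (- e).
  rewrite -powRD; last by apply/implyP => _; rewrite gt_eqF.
  rewrite -powR_mulrn ?(ltW T0)//; congr (_ `^ _).
  by rewrite natrB ?(leq_trans _ hd)//; lra.
rewrite powRN; set w := T `^ (d%:R - d%:R / q); have w0 : 0 < w by rewrite powR_gt0.
rewrite [leRHS](_ : _ = K * M * r `^ (d%:R - d%:R / q) * T `^ (- e) * (w / w)); last by lra.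
rewrite divff ?gt_eqF// mulr1 powRN ler_pdivlMr ?powR_gt0// mulrC -ler_pdivlMr// => h.
rewrite -[leLHS]powRr1 ?(ltW T0)// -[X in T `^ X](@divff _ e) ?gt_eqF// powRrM.
apply: ge0_ler_powR; rewrite ?nnegrE ?invr_ge0 ?powR_ge0 ?(ltW e0)//.
by rewrite divr_ge0// ?mulr_ge0 ?powR_ge0// ltW.
Qed.

Lemma critical_radius_lty x : (critical_radius V x < +oo)%E.
Proof.
have [B hB] := @ball_mass_large x 1 ler01.
rewrite critical_radiusE; apply: (@le_lt_trans _ _ B%:E); last by rewrite ltry.
apply: ge_ereal_sup => _ [T [T0 vT] <-]; rewrite lee_fin; apply: hB => //.
by rewrite mul1r.
Qed.

Local Notation rr x := (fine (critical_radius V x)).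

Lemma critical_radius_gt0 x : (0 < critical_radius V x)%E.
Proof.
have [K K1 hK] := critical_radius_ge.
have M1 : 1 <= Num.max 1 (v x 1) by rewrite le_max lexx.
apply: lt_le_trans (hK x 1 _ ltr01 M1 _).
  by rewrite lte_fin mul1r powR_gt0// mulr_gt0 ?(lt_le_trans _ K1)// (lt_le_trans _ M1).
by rewrite expr1n mulr1 le_max lexx orbT.
Qed.

Lemma critical_radius_fin x : critical_radius V x = (rr x)%:E.
Proof. by rewrite fineK// gt0_fin_numE ?critical_radius_gt0 ?critical_radius_lty. Qed.

Lemma fine_critical_radius_gt0 x : 0 < rr x.
Proof. by rewrite fine_gt0// critical_radius_gt0 critical_radius_lty. Qed.

(** With [S = |x-y| + rho(x)], the ball [B(y,S)] lies in [B(x,2S)], whose mass is controlled by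
    doubling from a radius close to [rho(x)]. The resulting bound on [v(y,S)] forces [rho(y)] to be
    large through [critical_radius_ge]. *)
Lemma critical_radius_lower : exists2 c : R, 0 < c <= 1 & exists k : nat, forall x y,
  c * rr x <= rr y * (1 + enorm (x - y) / rr x) ^+ k.
Proof.
have [K K1 hK] := critical_radius_ge.
have [m hm] := ball_mass_doubling kappa0 d0 q1 hV.
have K0 : 0 < K by exact: lt_le_trans K1.
pose L := K * (2 * 4 ^+ m).
have L1 : 1 <= L.
  rewrite -[leLHS]mulr1 ler_pM// -[leLHS]mulr1 ler_pM// ?exprn_ege1//; lra.
have L0 : 0 < L by exact: lt_le_trans L1.
(* The natural exponent is the real exponent [m/e] rounded up, which is harmless as [u >= 1]. *)
have [k hk] : exists k : nat, m%:R * e^-1 < k%:R.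
  exists (Num.bound (m%:R * e^-1)); apply: archi_boundP.
  by rewrite mulr_ge0 ?invr_ge0 ?(ltW e0).
exists (L `^ (- e^-1)).
  rewrite powR_gt0//= -[leRHS](powRr0 L); apply: ler_powR => //.
  by rewrite oppr_le0 invr_ge0 ltW.
exists k => x y; have p0 := fine_critical_radius_gt0 x.
pose S := enorm (x - y) + rr x.
have S0 : 0 < S by rewrite /S ltr_wpDl ?enorm_ge0.
pose u := S / rr x.
have uE : 1 + enorm (x - y) / rr x = u by rewrite /u mulrDl divff ?gt_eqF// addrC.
have u1 : 1 <= u by rewrite -uE lerDl divr_ge0 ?enorm_ge0 ?ltW.
have u0 : 0 < u by exact: lt_le_trans u1.
have um1 : 1 <= u ^+ m by rewrite exprn_ege1.
(* A competing radius above half the supremum suffices; the half is the source of the [4] in [L]. *)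
have [r [[r0 vr] [rS pr]]] : exists r, (0 < r /\ v x r <= r ^+ (d - 2)) /\ (r <= rr x /\ rr x < 2 * r).
  have : ((rr x / 2)%:E < critical_radius V x)%E.
    by rewrite critical_radius_fin lte_fin; lra.
  rewrite [X in (_ < X)%E]critical_radiusE => /ereal_sup_gt[_ [r [r0 vr] <-]]; rewrite lte_fin => pr.
  exists r; split => //; split; last by lra.
  rewrite -lee_fin -critical_radius_fin critical_radiusE.
  by apply: ereal_sup_ubound; exists r.
have vy : v y S <= 2 * 4 ^+ m * u ^+ m * S ^+ (d - 2).
  apply: (@le_trans _ _ (v x (2 * S))).
    apply: (le_ball_mass hV); rewrite edistC /S; lra.
  have rS2 : 0 < r <= 2 * S.
    by rewrite r0/= (le_trans rS)// /S; have := enorm_ge0 (x - y); lra.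
  apply: (le_trans (hm x _ _ rS2)).
  apply: ler_pM; rewrite ?(ball_mass_ge0 hV)//.
  - by rewrite mulr_ge0 ?exprn_ge0 ?divr_ge0 ?mulr_ge0 ?ltW.
  - rewrite -[leRHS]mulrA ler_wpM2l// -exprMn; apply: lerXn2r.
    + by rewrite nnegrE divr_ge0 ?mulr_ge0 ?ltW.
    + by rewrite nnegrE mulr_ge0 ?ltW.
    + rewrite /u ler_pdivrMr//.
      rewrite [leRHS](_ : _ = 4 * S * (r / rr x)); last by lra.
      have : 2^-1 <= r / rr x by rewrite ler_pdivlMr//; lra.
      have : 0 <= S by exact: ltW.
      nra.
  - apply: (le_trans vr); apply: lerXn2r; rewrite ?nnegrE ?(ltW r0) ?(ltW S0)//.
    by rewrite (le_trans rS)// /S lerDr enorm_ge0.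
have M1 : 1 <= 2 * 4 ^+ m * u ^+ m.
  rewrite -[leLHS]mulr1 ler_pM// -[leLHS]mulr1 ler_pM// ?exprn_ege1//; lra.
have := hK y _ _ S0 M1 vy; rewrite critical_radius_fin lee_fin mulrA -/L.
rewrite powRM ?exprn_ge0 ?(ltW L0) ?(ltW u0)// => h.
have uk0 : 0 < u ^+ k by rewrite exprn_gt0.
rewrite uE -(ler_pdivrMr _ _ uk0).
apply: le_trans h.
rewrite -(powR_mulrn m (ltW u0)) -powRrM.
rewrite [leLHS](_ : _ = L `^ (- e^-1) * (rr x * u `^ (- k%:R))); last first.
  by rewrite (powRN u) powR_mulrn ?(ltW u0)// mulrA.
rewrite [leRHS]mulrCA; apply: ler_wpM2l; first exact: powR_ge0.
apply: ler_pM; rewrite ?powR_ge0 ?(ltW p0)//.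
  by rewrite /S lerDr enorm_ge0.
by apply: ler_powR => //; lra.
Qed.

Lemma critical_radius_comparison : exists2 C : R, 1 <= C & exists k : nat,
  forall x (r : R) y z (s : R), 0 < r -> 0 < s -> eball x r y -> eball x r z ->
  1 + 3 * s / rr z <= C * (1 + r / rr x) ^+ k * (1 + s / rr y).
Proof.
have [c c01 [k hk]] := critical_radius_lower.
have [C C1 hC] := slowly_varying_comparison (p := fun x => rr x) fine_critical_radius_gt0 c01 hk.
by exists C => //; exists k.+1.
Qed.

End critical_radius_comparison.

(** * Measurability of the maximal function *)

(** Bolzano-Weierstrass, by compactness of the segment. *)
Lemma bounded_seq_cluster (R : realType) (s : nat -> R) (a b : R) :
  (forall n, a <= s n <= b) ->
  exists2 r, a <= r <= b & forall (e : R) (N : nat), 0 < e ->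
    exists2 n, (N <= n)%N & `|s n - r| < e.
Proof.
move=> sab; have cK := @segment_compact R a b.
have [|r [rab rs]] := cK (s @ \oo) _; first by exists 0%N => // n _ /=; rewrite in_itv/=.
exists r; first by move: rab; rewrite /= in_itv.
move=> e N e0; have [] := rs [set s n | n in [set n | (N <= n)%N]] (ball r e).
- by exists N => // n Nn /=; exists n.
- exact: nbhsx_ballx.
- by move=> _ [[n Nn <-] rn]; exists n => //; rewrite distrC.
Qed.

Section measurability.
Context {R : realType} {d : nat}.
Implicit Types x y z : 'rV[R]_d.
Local Notation mu := (@lebesgue R d).
Local Notation kappa := (unit_ball_volume R d).
Hypothesis kappa0 : (0 < kappa)%R.
Hypothesis hd : (3 <= d)%N.
Variables (q : R) (V : 'rV[R]_d -> R).
Hypothesis hq : d%:R / 2 < q.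
Hypothesis hV : reverse_holder q V.
Hypothesis hV0 : ~ {ae mu, forall x, V x = 0}.
Local Notation v := (ball_mass V).

Let V0E x : (0 <= (V x)%:E)%E.
Proof. by rewrite lee_fin; have [] := hV. Qed.

Let mVE : measurable_fun [set: euclid R d] (EFin \o V).
Proof. by apply/measurable_EFinP; have [_ []] := hV. Qed.

Lemma measurable_ball_mass_lt (s c : R) : 0 < s ->
  measurable ([set x | v x s < c] : set (euclid R d)).
Proof.
move=> s0; have := measurable_ball_integral mVE V0E s0.
move=> /(emeasurable_fun_infty_o measurableT)/(_ c%:E); rewrite setTI.
by under eq_set do rewrite (ball_massE hV) lte_fin.
Qed.

(* The radii on the right are rational, whence measurability in [x]; the slack
   [1/(n+1)] is absorbed by compactness of the bounded set of radii. *)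
Lemma critical_radius_geP (a : R) x : 0 < a ->
  (a%:E <= critical_radius V x)%E <->
  forall n : nat, exists s : rat, [/\ 0 < ratr s :> R, a - n.+1%:R^-1 < ratr s &
    v x (ratr s) < ratr s ^+ (d - 2) * (1 + n.+1%:R^-1)].
Proof.
have d2 : (0 < d - 2)%N by rewrite subn_gt0.
move=> a0; split.
  move=> ax n; have n0 : 0 < n.+1%:R^-1 :> R by rewrite invr_gt0.
  have : ((a - n.+1%:R^-1)%:E < critical_radius V x)%E.
    by apply: lt_le_trans ax; rewrite lte_fin ltrBlDr ltrDl.
  rewrite (critical_radiusE hV) => /ereal_sup_gt[_ [r [r0 vr] <-]]; rewrite lte_fin => ar.
  pose h : R := 1 + n.+1%:R^-1; have h1 : 1 < h by rewrite ltrDl.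
  have h0 : 0 < h by exact: lt_trans h1.
  (* Since [t^(d-2) h = 1], any [s] between [r t] and [r] satisfies [v(x,s) <= r^(d-2) < s^(d-2) h];
     this is the room for a rational radius. *)
  pose t := h `^ (- (d - 2)%:R^-1).
  have t0 : 0 < t by rewrite powR_gt0.
  have t1 : t < 1.
    rewrite /t powRN invf_lt1 ?powR_gt0//.
    apply: (@le_lt_trans _ _ (1 `^ (d - 2)%:R^-1)); first by rewrite powR1.
    by apply: gt0_ltr_powR; rewrite ?invr_gt0 ?ltr0n ?nnegrE ?(ltW h0).
  have td : t ^+ (d - 2) * h = 1.
    rewrite -(powR_mulrn _ (ltW t0)) -powRrM mulNr mulVf ?pnatr_eq0 -?lt0n//.
    by rewrite powR_inv1 ?(ltW h0)// mulVf ?gt_eqF.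
  have tr : Num.max (r * t) (a - n.+1%:R^-1) < r.
    by rewrite gt_max ar andbT gtr_pMr.
  have [s] := rat_in_itvoo tr; rewrite in_itv/= gt_max => /andP[/andP[rts as_] sr].
  have s0 : 0 < ratr s :> R by apply: lt_trans rts; rewrite mulr_gt0.
  exists s; split => //.
  apply: (@le_lt_trans _ _ (v x r)).
    by apply: (le_ball_mass hV); rewrite subrr enorm0 add0r ltW.
  apply: (le_lt_trans vr); rewrite -/h -[ltLHS]mulr1 -td mulrA -exprMn ltr_pM2r//.
  by rewrite ltr_pXn2r// nnegrE ltW// mulr_gt0.
move=> hs; have [s {}hs] := choice hs.
have [B hB] := ball_mass_large kappa0 hd hq hV hV0 x (ler0n R 2).
have sB n : 0 <= (ratr (s n) : R) <= B.
  have [s0 _ vs] := hs n; apply/andP; split; [exact: ltW | apply: hB => //].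
  apply: (le_trans (ltW vs)); rewrite mulrC; apply: ler_wpM2r.
    by rewrite exprn_ge0// ltW.
  by rewrite -[leRHS]/(1 + 1) lerD2l invf_le1// ler1n.
have [r /andP[r0 rB] rs] := bounded_seq_cluster sB.
have invn (e : R) : 0 < e -> exists N : nat, forall n, (N <= n)%N -> n.+1%:R^-1 < e.
  move=> e0; exists (Num.bound e^-1) => n Nn; rewrite invf_plt ?posrE//.
  apply: (@lt_le_trans _ _ (Num.bound e^-1)%:R).
    by apply: archi_boundP; rewrite invr_ge0 ltW.
  by rewrite ler_nat (leq_trans Nn).
have ar : a <= r.
  rewrite leNgt; apply/negP => ra; pose e := (a - r) / 2.
  have e0 : 0 < e by rewrite /e; lra.
  have [N hN] := invn e e0; have [n Nn] := rs e N e0.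
  have [_ + _] := hs n; have := hN n Nn; rewrite /e ltr_norml.
  by move: n.+1%:R^-1 => w ? ? /andP[? ?]; lra.
apply: (@le_trans _ _ r%:E); first by rewrite lee_fin.
have {}r0 : 0 < r by exact: lt_le_trans ar.
rewrite (critical_radiusE hV); apply: ereal_sup_ubound; exists r => //; split => //.
(* If the limit radius failed the defining inequality, some [s' < r] would already have mass above
   [r^(d-2)], and radii [s n] close to [r] would exceed [s']. *)
rewrite leNgt; apply/negP => vr.
have : ((r ^+ (d - 2))%:E < \int[mu]_(y in eball x r) (V y)%:E)%E.
  by rewrite (ball_massE hV) lte_fin.
move=> /(ball_integral_left_cont mVE V0E r0)[s' /andP[s'0 s'r]].
rewrite (ball_massE hV) lte_fin => vs'.
have rd0 : 0 < r ^+ (d - 2) by rewrite exprn_gt0.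
pose w := v x s' / r ^+ (d - 2); have w1 : 1 < w by rewrite ltr_pdivlMr ?mul1r.
have w0 : 0 < w by exact: lt_trans w1.
(* The excess [w] is split into [d - 1] equal factors: [d - 2] of them absorb [s n < r b], the last
   one absorbs the slack [1 + 1/(n+1) < b]. *)
pose b := w `^ (d - 2).+1%:R^-1.
have b0 : 0 < b by rewrite powR_gt0.
have b1 : 1 < b.
  apply: (@le_lt_trans _ _ (1 `^ (d - 2).+1%:R^-1)); first by rewrite powR1.
  by apply: gt0_ltr_powR; rewrite ?invr_gt0 ?nnegrE ?(ltW w0).
have bd : b ^+ (d - 2).+1 = w.
  by rewrite -(powR_mulrn _ (ltW b0)) -powRrM mulVf ?powRr1 ?(ltW w0)// pnatr_eq0.
have [N hN] := invn (b - 1) ltac:(lra).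
have [|n Nn] := rs (Num.min (r - s') (r * (b - 1))) N.
  by rewrite lt_min subr_gt0 s'r mulr_gt0//; lra.
have [sn0 _ vs] := hs n; have nb := hN n Nn.
rewrite lt_min !ltr_norml => /andP[/andP[h1 h2] /andP[h3 h4]].
have : v x s' <= v x (ratr (s n)).
  by apply: (le_ball_mass hV); rewrite subrr enorm0 add0r; lra.
move=> /le_lt_trans/(_ vs); apply/negP; rewrite -leNgt.
have -> : v x s' = (r * b) ^+ (d - 2) * b.
  by rewrite exprMn -mulrA -exprSr bd /w mulrC divfK ?gt_eqF.
apply: ler_pM; rewrite ?exprn_ge0 ?(ltW sn0) ?addr_ge0//.
- apply: lerXn2r; rewrite ?nnegrE ?(ltW sn0) ?mulr_ge0 ?(ltW r0) ?(ltW b0)//; lra.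
- by move: n.+1%:R^-1 nb => c ?; lra.
Qed.

Lemma measurable_critical_radius :
  measurable_fun [set: euclid R d] (critical_radius V).
Proof.
apply: (measurability _ (ErealGenCInfty.measurableE R)).
move=> /= _ [_ [a ->]] <-; apply: measurableI => //; rewrite preimage_itvcy.
have [a0|a0] := leP a 0.
  rewrite (_ : [set _ | _] = [set: euclid R d])//; apply/seteqP; split => // x _ /=.
  apply: le_trans (ltW (critical_radius_gt0 kappa0 hd hq hV x)).
  by rewrite lee_fin.
pose E (n : nat) (s : rat) : set (euclid R d) :=
  if (0 < ratr s :> R) && (a - n.+1%:R^-1 < ratr s) then
    [set x | v x (ratr s) < ratr s ^+ (d - 2) * (1 + n.+1%:R^-1)] else set0.
have mE n s : measurable (E n s).
  by rewrite /E; case: ifP => // /andP[s0 _]; exact: measurable_ball_mass_lt.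
rewrite (_ : [set _ | _] = \bigcap_n \bigcup_s E n s).
  by apply: bigcapT_measurable => n; apply: bigcupT_measurable_rat.
apply/seteqP; split => x /=.
  move=> /(critical_radius_geP _ a0) hs n _; have [s [s0 as_ vs]] := hs n.
  by exists s => //; rewrite /E s0 as_.
move=> hs; apply/(critical_radius_geP _ a0) => n; have [s _] := hs n I.
by rewrite /E; case: ifP => // /andP[s0 as_] vs; exists s.
Qed.

Local Notation rho := (critical_radius V).
Local Notation rr x := (fine (critical_radius V x)).

Lemma growthE (theta : R) x (r : R) : growth rho theta x r = ((1 + r / rr x) `^ theta)%:E.
Proof.
rewrite /growth {1}(critical_radius_fin kappa0 hd hq hV hV0 x) inver gt_eqF//.
exact: (fine_critical_radius_gt0 kappa0 hd hq hV hV0 x).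
Qed.

Lemma growth_inv (theta : R) x (r : R) : 0 < r ->
  ((growth rho theta x r)^-1)%E = ((1 + r / rr x) `^ (- theta))%:E.
Proof.
move=> r0; rewrite growthE inver powRN gt_eqF// powR_gt0// ltr_wpDr// divr_ge0 ?ltW//.
exact: (fine_critical_radius_gt0 kappa0 hd hq hV hV0 x).
Qed.

Variables (theta : R) (g : 'rV[R]_d -> R).
Hypothesis theta0 : 0 <= theta.
Hypothesis lg : L1loc g.

Let g0 y : (0 <= `|g y|%:E)%E. Proof. by rewrite lee_fin. Qed.

Let mg := L1loc_measurable lg.

Definition maximal_term x (r : R) : \bar R :=
  (((1 + r / rr x) `^ (- theta))%:E *
   (((r ^+ d * kappa)^-1)%:E * \int[mu]_(y in eball x r) `|g y|%:E))%E.

Lemma maximal_termE x (r : R) : 0 < r ->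
  ((growth rho theta x r)^-1 * average (fun y => `|g y|%:E) (eball x r))%E
  = maximal_term x r.
Proof.
move=> r0; rewrite (growth_inv _ _ r0) /average (inv_mu_eball kappa0 _ r0).
by rewrite /maximal_term.
Qed.

(** Shrinking the radius increases both real factors and lowers the integral as little as desired,
    so rational radii exhaust the supremum. *)
Lemma maximal_term_left_lower x (r : R) (a : \bar R) : 0 < r ->
  (a < maximal_term x r)%E ->
  exists s : rat, 0 < ratr s :> R /\ (a < maximal_term x (ratr s))%E.
Proof.
move=> r0; rewrite /maximal_term.
have p0 := fine_critical_radius_gt0 kappa0 hd hq hV hV0 x.
have G0 (t : R) : 0 < t -> 0 < (1 + t / rr x) `^ (- theta).
  by move=> t0; rewrite powR_gt0// ltr_wpDr// divr_ge0 ?ltW.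
have B0 (t : R) : 0 < t -> 0 < (t ^+ d * kappa)^-1.
  by move=> t0; rewrite invr_gt0 mulr_gt0 ?exprn_gt0.
rewrite muleA -EFinM; set c := (_ * _)%R.
have c0 : 0 < c by rewrite mulr_gt0 ?G0 ?B0.
have I0 (A : set 'rV[R]_d) : (0 <= \int[mu]_(y in A) `|g y|%:E)%E.
  by apply: integral_ge0 => y _; exact: g0.
rewrite -[c]invrK -lte_pdivrMl ?invr_gt0// => /(ball_integral_left_cont mg g0 r0).
case=> s /andP[s0 sr] as_.
have [t] := rat_in_itvoo sr; rewrite in_itv/= => /andP[st tr].
have t0 : 0 < ratr t :> R by exact: lt_trans st.
exists t; split => //.
move: as_; rewrite lte_pdivrMl ?invr_gt0// invrK => /lt_le_trans; apply.
rewrite muleA -EFinM; apply: lee_pmul; rewrite ?lee_fin ?(ltW c0)//.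
- apply: ler_pM; rewrite ?(ltW (G0 _ r0)) ?(ltW (B0 _ r0))//.
  + have u0 (b : R) : 0 < b -> 0 < 1 + b / rr x.
      by move=> b0; rewrite ltr_wpDr// divr_ge0 ?ltW.
    rewrite !powRN lef_pV2 ?posrE; last 2 first.
    * exact/powR_gt0/u0.
    * exact/powR_gt0/u0.
    apply: ge0_ler_powR => //; [exact/ltW/u0|exact/ltW/u0|].
    by rewrite lerD2l ler_pM2r ?invr_gt0// ltW.
  + rewrite lef_pV2 ?posrE ?mulr_gt0 ?exprn_gt0// ler_pM2r//.
    by apply: lerXn2r; rewrite ?nnegrE ltW.
- apply: le_ball_integral => //; first exact: measurable_eball.
  by apply: eball_sub; rewrite subrr enorm0 add0r ltW.
Qed.

Lemma measurable_maximal_term (r : R) : 0 < r ->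
  measurable_fun [set: euclid R d] (maximal_term ^~ r).
Proof.
move=> r0; apply: emeasurable_funM; last first.
  by apply: measurable_funeM; exact: measurable_ball_integral.
apply/measurable_EFinP.
have mp : measurable_fun [set: euclid R d] (fun x => rr x).
  by apply: (measurableT_comp (fine_measurable measurableT)); exact: measurable_critical_radius.
(* The inverse is written as a power so that measurability of power functions applies. *)
have -> : (fun x => (1 + r / rr x) `^ (- theta)) =
   (fun t => t `^ (- theta)) \o (fun x => 1 + r * rr x `^ (-1)).
  apply/funext => x /=; rewrite powR_inv1// ltW//.
  exact: (fine_critical_radius_gt0 kappa0 hd hq hV hV0 x).
apply: (measurableT_comp (measurable_powR _)).
apply: measurable_funD; first exact: measurable_cst.
apply: measurable_funM; first exact: measurable_cst.
exact: (measurableT_comp (measurable_powR _)).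
Qed.

Lemma measurable_maximal_fun :
  measurable_fun [set: euclid R d] (maximal_fun rho theta g).
Proof.
apply: (measurability _ (ErealGenOInfty.measurableE R)).
move=> /= _ [_ [a ->]] <-; apply: measurableI => //; rewrite preimage_itvoy.
pose E (s : rat) : set (euclid R d) :=
  if 0 < ratr s :> R then [set x | a%:E < maximal_term x (ratr s)]%E else set0.
rewrite (_ : [set _ | _] = \bigcup_s E s).
  apply: bigcupT_measurable_rat => s; rewrite /E; case: ifPn => // s0.
  have := emeasurable_fun_o_infty measurableT (measurable_maximal_term s0) a%:E.
  by rewrite setTI.
apply/seteqP; split => x /=.
  move=> /ereal_sup_gt[_ [r r0 <-]]; rewrite (maximal_termE _ r0).
  move=> /(maximal_term_left_lower r0)[s [s0 as_]].
  by exists s => //; rewrite /E s0.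
move=> [s _]; rewrite /E; case: ifPn => // s0 /= as_.
apply: (lt_le_trans as_); apply: ereal_sup_ubound.
by exists (ratr s) => //; exact: maximal_termE.
Qed.

End measurability.

(** * Weight inequality *)

Lemma ler_powRN_mul (R : realType) (a b c t : R) : 0 < a -> 0 < b -> 0 < c ->
  0 <= t -> b <= c * a -> a `^ (- t) <= c `^ t * b `^ (- t).
Proof.
move=> a0 b0 c0 t0 h; rewrite !powRN ler_pdivlMr ?powR_gt0// mulrC.
rewrite ler_pdivrMr ?powR_gt0// -powRM ?(ltW a0) ?(ltW c0)//.
by apply: ge0_ler_powR => //; rewrite nnegrE ?mulr_ge0 ?ltW.
Qed.

Lemma lee_pmul3 (R : realType) (a b e a' b' : R) (I I' : \bar R) : 0 <= a -> 0 <= b ->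
  a * b <= e * a' * b' -> (0 <= I)%E -> (I <= I')%E ->
  (a%:E * (b%:E * I) <= e%:E * (a'%:E * (b'%:E * I')))%E.
Proof.
move=> a0 b0 ab I0 II'; rewrite !muleA -!EFinM.
by apply: lee_pmul; rewrite // lee_fin mulr_ge0.
Qed.

Lemma eball_sub_tripled (R : realType) (d : nat) (x y z : 'rV[R]_d) (r s : R) :
  eball x r y -> eball x r z -> r <= s -> eball y s `<=` eball z (3 * s).
Proof.
move=> yB zB rs; apply: eball_sub; have := ler_edistD x y z.
by move: yB zB; rewrite /eball/= (edistC z x); lra.
Qed.

Lemma EFin_mulVK2 (R : realType) (a b : R) (I : \bar R) : 0 < a -> 0 < b ->
  ((b * a)%:E * (a^-1%:E * (b^-1%:E * I)) = I)%E.
Proof.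
move=> a0 b0; rewrite !muleA -!EFinM mulfK ?gt_eqF//.
by rewrite divff ?gt_eqF// mul1e.
Qed.

Lemma eball_double_sub (R : realType) (d : nat) (x z : 'rV[R]_d) (r : R) :
  eball x r z -> eball x (2 * r) `<=` eball z (3 * r).
Proof. by move=> zB; apply: eball_sub; move: zB; rewrite /eball/= edistC; lra. Qed.

Section A1_bound.
Context {R : realType} {d : nat}.
Implicit Types x y z : 'rV[R]_d.
Local Notation mu := (@lebesgue R d).
Local Notation kappa := (unit_ball_volume R d).
Hypothesis kappa0 : (0 < kappa)%R.
Hypothesis hd : (3 <= d)%N.
Variables (q : R) (V : 'rV[R]_d -> R).
Hypothesis hq : d%:R / 2 < q.
Hypothesis hV : reverse_holder q V.
Hypothesis hV0 : ~ {ae mu, forall x, V x = 0}.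
Variables (theta : R) (g : 'rV[R]_d -> R).
Hypothesis theta0 : 0 <= theta.
Hypothesis lg : L1loc g.
Local Notation rho := (critical_radius V).
Local Notation p x := (fine (critical_radius V x)).
Local Notation f := (fun y => `|g y|%:E).
Local Notation M := (maximal_fun rho theta g).
Local Notation term := (maximal_term V theta g).

Let g0 y : (0 <= f y)%E. Proof. by rewrite lee_fin. Qed.

Let mg := L1loc_measurable lg.

Let p0 x : 0 < p x.
Proof. exact: (fine_critical_radius_gt0 kappa0 hd hq hV hV0 x). Qed.

Lemma maximal_term_le x (r : R) : 0 < r -> (term x r <= M x)%E.
Proof.
move=> r0; apply: ereal_sup_ubound; exists r => //.
exact: (maximal_termE kappa0 hd hq hV hV0 theta g x r0).
Qed.

Lemma maximal_fun_ge0 x : (0 <= M x)%E.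
Proof.
apply: le_trans (maximal_term_le x ltr01); rewrite mule_ge0 ?lee_fin ?powR_ge0//.
rewrite mule_ge0 ?lee_fin ?invr_ge0 ?mulr_ge0 ?(ltW kappa0) ?exprn_ge0//.
by apply: integral_ge0 => y _; exact: g0.
Qed.

(** If the average exceeded the value [a] of [rat_maximal], a rational ball inside [B(x,s)]
    containing [x] would still have integral above [a mu(B(x,s))]. Its measure is no larger, so its
    average would exceed [a] as well. *)
Lemma average_le_rat_maximal (U : set 'rV[R]_d) x (s : R) : 0 < s ->
  eball x s `<=` U -> (average f (eball x s) <= rat_maximal f U x)%E.
Proof.
move=> s0 sU; rewrite leNgt; apply/negP => h.
have F0 := rat_maximal_ge0 g0 U x.
have [a aE] : exists a : R, rat_maximal f U x = a%:E.
  exists (fine (rat_maximal f U x)); rewrite fineK// ge0_fin_numE//.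
  by apply: lt_le_trans h _; rewrite leey.
rewrite aE in h F0; rewrite lee_fin in F0.
move: h; rewrite (lt_average_eball kappa0 _ _ _ s0).
move=> /(ball_integral_rat_ball mg g0 s0)[b [b0 bx bs ab]].
have : (a%:E < average f (rat_ball b))%E.
  rewrite (lt_average_eball kappa0 _ _ _ b0); apply: le_lt_trans ab.
  by apply: lee_wpmul2l; [rewrite lee_fin | apply: le_lebesgue_outer].
apply/negP; rewrite -leNgt -aE; apply: rat_maximal_ge => //.
by split => // y /bs /sU.
Qed.

Variables (C : R) (k : nat).
Hypothesis C1 : 1 <= C.
Hypothesis comparison : forall x (r : R) y z (s : R),
  0 < r -> 0 < s -> eball x r y -> eball x r z ->
  1 + 3 * s / p z <= C * (1 + r / p x) ^+ k * (1 + s / p y).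

(** The factor [3^d] is the volume ratio of tripled balls, the rest is the loss in comparing growth
    factors. The value [n = k] serves large radii, [n = k.+1] the integral over the doubled ball. *)
Local Notation E x r n := (3 ^+ d * (C * (1 + r / p x) ^+ n) `^ theta).

Let u1 x (r : R) : 0 < r -> 1 <= 1 + r / p x.
Proof. by move=> r0; rewrite lerDl divr_ge0 ?ltW. Qed.

Let Cu0 x (r : R) n : 0 < r -> 0 < C * (1 + r / p x) ^+ n.
Proof.
move=> r0; rewrite mulr_gt0 ?(lt_le_trans _ C1)// exprn_gt0//.
exact: lt_le_trans (u1 x r0).
Qed.

Lemma maximal_term_far x (r : R) y z (s : R) : 0 < r -> r <= s ->
  eball x r y -> eball x r z -> (term y s <= (E x r k)%:E * M z)%E.
Proof.
move=> r0 rs yB zB; have s0 : 0 < s by exact: lt_le_trans rs.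
have s30 : 0 < 3 * s by rewrite mulr_gt0.
apply: (@le_trans _ _ ((E x r k)%:E * term z (3 * s))%E); last first.
  apply: lee_wpmul2l; last exact: maximal_term_le.
  by rewrite lee_fin mulr_ge0 ?exprn_ge0 ?powR_ge0.
have yz : 0 < 1 + s / p y by rewrite ltr_wpDr// divr_ge0// ltW.
have zz : 0 < 1 + 3 * s / p z by rewrite ltr_wpDr// divr_ge0// ltW.
have decay : (1 + s / p y) `^ (- theta) <=
    (C * (1 + r / p x) ^+ k) `^ theta * (1 + 3 * s / p z) `^ (- theta).
  apply: ler_powRN_mul; [exact: yz|exact: zz|exact: Cu0|exact: theta0|].
  exact: comparison.
have b0 (t : R) : 0 < t -> 0 <= (t ^+ d * kappa)^-1.
  by move=> t0; rewrite invr_ge0 mulr_ge0 ?(ltW kappa0)// exprn_ge0// ltW.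
have vol : (s ^+ d * kappa)^-1 = 3 ^+ d * ((3 * s) ^+ d * kappa)^-1.
  by rewrite exprMn -mulrA [in RHS]invfM mulrA divff ?mul1r// expf_neq0.
apply: lee_pmul3.
- exact: powR_ge0.
- exact: b0.
- rewrite vol; move: ((3 * s) ^+ d * kappa)^-1 (b0 _ s30) => b b1.
  apply: (le_trans (ler_wpM2r _ decay)); first by rewrite mulr_ge0 ?exprn_ge0.
  rewrite le_eqVlt; apply/orP; left; apply/eqP.
  by rewrite mulrACA [X in X * _]mulrC !mulrA.
- by apply: integral_ge0 => t _; exact: g0.
- apply: (le_ball_integral mg g0); first exact: measurable_eball.
  exact: (eball_sub_tripled yB zB rs).
Qed.

Lemma maximal_fun_split x (r : R) y z : 0 < r -> eball x r y -> eball x r z ->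
  (M y <= maxe (rat_maximal f (eball x (2 * r)) y) ((E x r k)%:E * M z))%E.
Proof.
move=> r0 yB zB; apply: ge_ereal_sup => _ [s s0 <-].
rewrite (maximal_termE kappa0 hd hq hV hV0 _ _ _ s0) le_max.
have [rs|sr] := leP r s.
  by apply/orP; right; exact: maximal_term_far.
apply/orP; left.
apply: (@le_trans _ _ (average f (eball y s))); last first.
  apply: average_le_rat_maximal => //; apply: eball_sub.
  by move: yB; rewrite /eball/=; lra.
rewrite /average (inv_mu_eball kappa0 _ s0) /maximal_term.
set t := (_ * _)%E; rewrite -[leRHS]mul1e; apply: lee_wpmul2r.
  rewrite mule_ge0 ?lee_fin ?invr_ge0 ?mulr_ge0 ?(ltW kappa0) ?exprn_ge0 ?(ltW s0)//.
  by apply: integral_ge0 => a _; exact: g0.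
(* For small radii the growth factor is simply bounded by [1]. *)
rewrite lee_fin -[leRHS](powRr0 (1 + s / p y)); apply: ler_powR; first exact: u1.
by rewrite oppr_le0.
Qed.

Lemma ball_integral_le_maximal x (r : R) z : 0 < r -> eball x r z ->
  (\int[mu]_(y in eball x (2 * r)) f y <=
    ((r ^+ d * kappa) * E x r k.+1)%:E * M z)%E.
Proof.
move=> r0 zB; have r30 : 0 < 3 * r by rewrite mulr_gt0.
have zz : 0 < 1 + 3 * r / p z by rewrite ltr_wpDr// divr_ge0// ltW.
have b0 : 0 < (3 * r) ^+ d * kappa by rewrite mulr_gt0 ?exprn_gt0.
apply: (@le_trans _ _ (((3 * r) ^+ d * kappa * (1 + 3 * r / p z) `^ theta)%:E *
    term z (3 * r))%E).
  rewrite /maximal_term powRN EFin_mulVK2; [|by rewrite powR_gt0|exact: b0].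
  apply: (le_ball_integral mg g0); first exact: measurable_eball.
  exact: eball_double_sub.
apply: (@le_trans _ _ (((3 * r) ^+ d * kappa * (1 + 3 * r / p z) `^ theta)%:E * M z)%E).
  apply: lee_wpmul2l; last exact: maximal_term_le.
  by rewrite lee_fin mulr_ge0 ?powR_ge0// ltW.
apply: lee_wpmul2r; first exact: maximal_fun_ge0.
rewrite lee_fin exprMn.
rewrite [leRHS](_ : _ = 3 ^+ d * r ^+ d * kappa * (C * (1 + r / p x) ^+ k.+1) `^ theta); last by lra.
apply: ler_wpM2l; first by rewrite -exprMn ltW.
apply: ge0_ler_powR; rewrite ?nnegrE ?(ltW zz) ?(ltW (Cu0 _ _ _))//.
(* With [y = x] and [s = r] the factor [1 + s / p y] is the growth base of the ball itself, whence
   the exponent [k.+1]. *)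
have := comparison r0 r0 (eball_center x r0) zB.
by rewrite exprSr mulrA.
Qed.

Lemma poweR_maximal_average (delta : R) : 0 < delta < 1 -> exists2 K : R, 0 <= K &
  forall x (r : R) z, 0 < r -> eball x r z ->
  (average (fun y => M y `^ delta) (eball x r) <=
    (K * (1 + r / p x) `^ (k.+1%:R * theta * delta))%:E * M z `^ delta)%E.
Proof.
move=> delta01; have /andP[delta0 delta1] := delta01.
pose c : R := 1 + 3 ^+ d * 2 `^ delta / (1 - 2 `^ (delta - 1)).
have c0 : 0 <= c.
  rewrite /c addr_ge0// divr_ge0 ?mulr_ge0 ?powR_ge0 ?exprn_ge0// subr_ge0.
  rewrite -[leRHS](powRr0 2); apply: ler_powR; first by rewrite ler1n.
  by rewrite subr_le0 ltW.
(* The summand [c] comes from Kolmogorov's inequality for small radii, the [1] from large ones. *)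
pose K := (c + 1) * (3 ^+ d * C `^ theta) `^ delta.
have K0 : 0 < K.
  rewrite mulr_gt0 ?ltr_wpDl// powR_gt0// mulr_gt0 ?exprn_gt0// powR_gt0//.
  exact: lt_le_trans C1.
exists K; first exact: ltW.
move=> x r z r0 zB; set u := 1 + r / p x.
have ux : 1 <= u by exact: u1.
have u0 : 0 < u by exact: lt_le_trans ux.
(* An infinite value at [z] makes the right-hand side infinite; beyond this case [M z] is a real
   number [w]. *)
have [Mz|] := eqVneq (M z) +oo%E.
  by rewrite Mz poweRyr ?gt_eqF// gt0_muley ?leey// lte_fin mulr_gt0// powR_gt0.
have Mz0 := maximal_fun_ge0 z; rewrite -ltey -ge0_fin_numE// => /fineK.
set w := fine _ => wE; have w0 : 0 <= w by rewrite fine_ge0.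
pose m := r ^+ d * kappa; have m0 : 0 < m by rewrite mulr_gt0 ?exprn_gt0.
pose A := E x r k.+1 * w.
have E0 n : 0 <= E x r n by rewrite mulr_ge0 ?exprn_ge0 ?powR_ge0.
have A0 : 0 <= A by rewrite mulr_ge0.
pose F := rat_maximal f (eball x (2 * r)).
have mB := measurable_eball x r.
have mF : measurable_fun [set: euclid R d] F by exact: measurable_rat_maximal.
have F0 y : (0 <= F y)%E by exact: rat_maximal_ge0.
have near_part : (\int[mu]_(y in eball x r) F y `^ delta <= (c * A `^ delta * m)%:E)%E.
  apply: (@kolmogorov_inequality _ _ _ _ delta (3 ^+ d) A m) => //.
  - exact: mu_eballE.
  - move=> a a0; apply: le_trans (rat_maximal_weak_type kappa0 mg g0 _ a0) _.
      exact: measurable_eball.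
    rewrite -mulrA EFinM; apply: lee_wpmul2l; first by rewrite lee_fin exprn_ge0.
    apply: (le_trans (ball_integral_le_maximal r0 zB)).
    by rewrite -wE -EFinM lee_fin /A -/m; lra.
pose D := E x r k * w.
have D0 : 0 <= D by rewrite mulr_ge0.
(* The bound for large radii is absorbed into the level [A] already used for small ones. *)
have DA : D <= A.
  apply: ler_wpM2r => //; apply: ler_wpM2l; first by rewrite exprn_ge0.
  apply: ge0_ler_powR; rewrite ?nnegrE ?(ltW (Cu0 _ _ _))//.
  apply: ler_wpM2l; first by rewrite (le_trans ler01).
  by rewrite exprS ler_peMl// exprn_ge0// ltW.
have mFd : measurable_fun [set: euclid R d] (fun y => F y `^ delta)%E.
  exact: (measurableT_comp (measurable_poweR delta)).
have mM : measurable_fun [set: euclid R d] (fun y => M y `^ delta)%E.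
  apply: (measurableT_comp (measurable_poweR delta)).
  exact: (measurable_maximal_fun kappa0 hd hq hV hV0 theta0 lg).
have total : (\int[mu]_(y in eball x r) M y `^ delta <=
    (c * A `^ delta * m)%:E + (A `^ delta * m)%:E)%E.
  apply: (@le_trans _ _ (\int[mu]_(y in eball x r) (F y `^ delta + (A `^ delta)%:E))%E).
    apply: ge0_le_integral; first exact: mB.
    - by move=> y _; exact: poweR_ge0.
    - exact: measurable_funTS.
    - apply: emeasurable_funD; last exact: measurable_cst.
      exact: measurable_funTS.
    - move=> y yB; have := maximal_fun_split r0 yB zB.
      rewrite -wE -EFinM -/D le_max => /orP[h|h].
      + apply: (@le_trans _ _ (F y `^ delta)%E); last by rewrite leeDl// lee_fin powR_ge0.
        apply: gt0_ler_poweR => //; first exact: ltW.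
          by rewrite in_itv/= leey andbT maximal_fun_ge0.
        by rewrite in_itv/= leey andbT.
      + apply: (@le_trans _ _ (A `^ delta)%:E); last by rewrite leeDr// poweR_ge0.
        rewrite -poweR_EFin; apply: gt0_ler_poweR; first exact: ltW.
        * by rewrite in_itv/= leey andbT maximal_fun_ge0.
        * by rewrite in_itv/= leey andbT lee_fin.
        * by apply: (le_trans h); rewrite lee_fin.
  rewrite ge0_integralD; last 5 first.
  - exact: mB.
  - by move=> y _; exact: poweR_ge0.
  - exact: measurable_funTS.
  - by move=> y _; rewrite lee_fin powR_ge0.
  - exact: measurable_cst.
  apply: leeD; first exact: near_part.
  rewrite integral_cst; last exact: mB.
  by rewrite [X in ((A `^ delta)%:E * X)%E](mu_eballE _ r0) -EFinM.
rewrite /average (inv_mu_eball kappa0 _ r0) lee_pdivrMl//.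
apply: (le_trans total).
rewrite -wE poweR_EFin -!EFinM -EFinD lee_fin le_eqVlt; apply/orP; left; apply/eqP.
have -> : A `^ delta = (3 ^+ d * C `^ theta) `^ delta *
    u `^ (k.+1%:R * theta * delta) * w `^ delta.
  have C0 : 0 <= C by rewrite (le_trans ler01).
  have -> : A = 3 ^+ d * C `^ theta * u `^ (k.+1%:R * theta) * w.
    rewrite /A (@powRM _ C) ?exprn_ge0 ?(ltW u0)// mulrA.
    by rewrite -(@powR_mulrn _ u) ?(ltW u0)// -powRrM.
  have D1 : 0 <= 3 ^+ d * C `^ theta by rewrite mulr_ge0 ?exprn_ge0 ?powR_ge0.
  rewrite powRM ?(mulr_ge0 D1) ?powR_ge0// (powRM _ D1) ?powR_ge0//.
  by rewrite -(powRrM u).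
rewrite -/m /K; lra.
Qed.

End A1_bound.

Theorem lemma4 (R : realType) (d : nat) (q : R) (V g : 'rV[R]_d -> R)
    (theta delta : R)
    (hd : (3 <= d)%N)
    (hq : d%:R / 2 < q)
    (hV : reverse_holder q V)
    (hV0 : ~ {ae @lebesgue R d, forall x, V x = 0})
    (hg : L1loc g)
    (htheta : 0 <= theta)
    (hdelta : 0 < delta < 1) :
  A1_infty (critical_radius V)
    (fun x => (maximal_fun (critical_radius V) theta g x `^ delta)%E).
Proof.
have kappa0 := unit_ball_volume_gt0 hV0.
have [C C1 [k comparison]] := critical_radius_comparison kappa0 hd hq hV hV0.
have [K K0 hK] := poweR_maximal_average kappa0 hd hq hV hV0 htheta hg C1 comparison hdelta.
have /andP[delta0 _] := hdelta.
exists (k.+1%:R * theta * delta); first by rewrite !mulr_ge0// ltW.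
split.
  split; last by move=> x; exact: poweR_ge0.
  apply: (measurableT_comp (measurable_poweR delta)).
  exact: (measurable_maximal_fun kappa0 hd hq hV hV0 htheta hg).
(* Adding [1] makes the constant positive, so that it can be moved to the other side of the
   inequality. *)
exists (K + 1) => x r r0.
have p0 := fine_critical_radius_gt0 kappa0 hd hq hV hV0 x.
rewrite (growthE kappa0 hd hq hV hV0) -EFinM.
set G := (K + 1) * _; have G0 : 0 < G.
  by rewrite mulr_gt0 ?ltr_wpDl// powR_gt0// ltr_wpDr// divr_ge0 ?ltW.
(* The average bound holds at every [z] of the ball, so it bounds the essential infimum; outside the
   ball the patched weight is [+oo]. *)
rewrite -lee_pdivrMl//; apply/ess_infP; apply: aeW => z.
rewrite /patch; case: ifPn => [|_]; last by rewrite leey.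
rewrite inE => zB; rewrite lee_pdivrMl//; apply: le_trans (hK x r z r0 zB) _.
apply: lee_wpmul2r; first exact: poweR_ge0.
by rewrite lee_fin; apply: ler_wpM2r; [exact: powR_ge0 | rewrite lerDl].
Qed.
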